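(* For every $c>0$ there exists $K$ such that the following holds for all $d\geq K$ and all $p\in[0,1]$ with $p\geq K/d$ (where $d$ and $p$ may depend on $n$). Let $G$ be a graph on $n$ vertices with average degree $d$. Then, with probability tending to $1$ as $n\to\infty$, the random graph $G_p$ contains a cycle of length at least $(1-c)d$. In particular, if $G$ has average degree $d$ and $p=\omega(1/d)$, then $G_p$ contains a cycle of length at least $(1-o(1))d$ asymptotically almost surely (as $n\to\infty$).
   Context: All graphs are finite and simple. For a graph $G$ and $p\in[0,1]$, $G_p$ denotes the random subgraph of $G$ on the vertex set $V(G)$ obtained by keeping each edge of $G$ independently with probability $p$. ''With probability tending to $1$ as $n\to\infty$'' (equivalently ''asymptotically almost surely'') means: for every sequence of admissible triples $(G_n,d_n,p_n)$ with $|V(G_n)|=n\to\infty$, the probability of the event for $(G_n)_{p_n}$ tends to $1$. In the second part, $p=\omega(1/d)$ means $p_nd_n\to\infty$, and the conclusion means that there is a sequence $\varepsilon_n\to 0$ such that $(G_n)_{p_n}$ contains a cycle of length at least $(1-\varepsilon_n)d_n$ with probability tending to $1$. *)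

(* Defs.v *)
From mathcomp Require Import all_boot all_order all_algebra.
From mathcomp Require Import all_classical all_reals all_analysis.

Set Implicit Arguments.
Unset Strict Implicit.
Unset Printing Implicit Defensive.
Import Order.TTheory GRing.Theory Num.Theory.
Import numFieldNormedType.Exports.
Local Open Scope ring_scope.

Record sgraph (T : finType) := SGraph {
  adj :> rel T;
  adj_sym : symmetric adj;
  adj_irr : irreflexive adj }.

Section Graphs.
Variables (R : realType) (T : finType).
Implicit Types (G : sgraph T) (F : {set {set T}}) (p x : R).

Definition degree G (v : T) : nat := #|[set w | G v w]|.

Definition average_degree G : R := (\sum_(v : T) degree G v)%N%:R / #|T|%:R.

Definition edges G : {set {set T}} :=
  [set e | [exists u, exists v, G u v && (e == [set u; v])]].

(* The spanning subgraph (V(G), E(G) :&: F). *)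
Definition keep_adj G F : rel T := fun u v => G u v && ([set u; v] \in F).

Lemma keep_adj_sym G F : symmetric (keep_adj G F).
Proof. by move=> u v; rewrite /keep_adj adj_sym finset.setUC. Qed.

Lemma keep_adj_irr G F : irreflexive (keep_adj G F).
Proof. by move=> u; rewrite /keep_adj adj_irr. Qed.

Definition keep_edges G F : sgraph T :=
  SGraph (keep_adj_sym G F) (keep_adj_irr G F).

(* The probability that the random subgraph G_p has property A: the set F of
   retained edges has the product Bernoulli(p) law on subsets of [edges G]. *)
Definition Pr_subgraph G p (A : sgraph T -> Prop) : R :=
  \sum_(F in powerset (edges G) | `[< A (keep_edges G F) >])
    \prod_(e in edges G) (if e \in F then p else 1 - p).

(* A cycle is listed by its vertices; in a simple graph it has at least three
   of them, which excludes the closed walk u, v, u along a single edge. *)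
Definition has_cycle_ge x G : Prop :=
  exists s : seq T, [/\ (3 <= size s)%N, ucycle G s & x <= (size s)%:R].

End Graphs.

Arguments average_degree R {T} G.

(* Main.v *)
(* The proof is a union bound over certificates. If H = G_p has no cycle of
   length (1 - c) d, we find a spanning forest contained in H, given by a parent
   map, and four vertex subsets which together determine a set of at least
   a n d edges of G, all of them missing from H. A forest with m edges lies in
   G_p with probability p^m, so the sum over all parent maps is at most
   \prod_v (1 + p deg v) <= (1 + p d)^n, and the probability of failure is at
   most (16 (1 + p d) exp(- a p d))^n.

   To find the missing edges, take a spanning forest of H of maximal total
   depth: every edge of H then joins a vertex to an ancestor, and to one at
   distance less than d, since otherwise it closes a long cycle. So if many edges
   of G are not of this form we are done. If not, cutting the forest yields
   disjoint vertex sets Q of size O(d) whose edges stay inside Q together with at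
   most d further ancestors; many of these pieces are graphs on N = O(d) vertices
   with average degree close to d. Either for each of those G has gamma N^2 edges
   between two vertex sets without an edge of H between them (and these sets are
   the rest of the certificate), or in one piece H meets every such pair.

   In that dense case a minimality argument gives a set W of minimum degree about
   d / 2 all of whose cuts are dense. Set aside reservoirs spread evenly over the
   parts of a weakly regular partition of W: they inherit the dense cuts, so H has
   an almost spanning component in each of them, which links any two large vertex
   sets. In the rest of W take a family of boundedly many disjoint paths of H
   covering as many vertices as possible. If it covered fewer than (1 - eps) d of
   them, the uncovered vertices would span few edges of G and on average be joined
   to more than half of the vertices of one of the paths; alternating between the
   two sides, H would contain a longer path to replace it. Linking the paths through
   the reservoirs closes the cycle. *)
From mathcomp Require Import all_boot all_order all_algebra.
From mathcomp Require Import zify ring lra.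

Set Implicit Arguments.
Unset Strict Implicit.
Unset Printing Implicit Defensive.
Import Order.TTheory GRing.Theory Num.Theory.
Local Open Scope ring_scope.

(** * Edge counts, dense subsets and depth-first search *)

(* Ordered pairs are counted: an edge with both ends in X :&: Y counts twice. *)
Definition ecount (R : numDomainType) (V : finType) (g : rel V) (X Y : {set V}) : R :=
  \sum_(x in X) \sum_(y in Y) (g x y)%:R.

Lemma big_disjointU (R : Type) (idx : R) (op : Monoid.com_law idx) (I : finType)
    (A B : {set I}) (F : I -> R) : [disjoint A & B] ->
  \big[op/idx]_(i in A :|: B) F i =
  op (\big[op/idx]_(i in A) F i) (\big[op/idx]_(i in B) F i).
Proof. by move=> dAB; rewrite -bigU //; apply: eq_bigl => i; rewrite !inE. Qed.

Section EdgeCount.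
Variables (R : realFieldType) (V : finType).
Implicit Types (g : rel V) (X Y A B : {set V}).
Local Notation e := (@ecount R V).

Lemma ecount_ge0 g X Y : 0 <= e g X Y.
Proof. by apply: sumr_ge0 => x _; apply: sumr_ge0 => y _; apply: ler0n. Qed.

Lemma ecountC g X Y : symmetric g -> e g X Y = e g Y X.
Proof.
move=> gC; rewrite /ecount exchange_big /=.
by apply: eq_bigr => x _; apply: eq_bigr => y _; rewrite gC.
Qed.

Lemma ecountUl g X Y A : [disjoint X & Y] ->
  e g (X :|: Y) A = e g X A + e g Y A.
Proof. by move=> dXY; rewrite /ecount big_disjointU. Qed.

Lemma ecountUr g X Y A : [disjoint X & Y] ->
  e g A (X :|: Y) = e g A X + e g A Y.
Proof.
move=> dXY; rewrite /ecount -big_split /=; apply: eq_bigr => x _.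
by rewrite big_disjointU.
Qed.

Lemma ecount_sumr g X Y : e g X Y = \sum_(x in X) e g [set x] Y.
Proof. by apply: eq_bigr => x _; rewrite /ecount big_set1. Qed.

Lemma ecount1E g v Y : e g [set v] Y = #|[set y in Y | g v y]|%:R.
Proof.
rewrite /ecount big_set1 -sum1_card natr_sum.
rewrite (eq_bigl (fun y => (y \in Y) && g v y)) => [|y]; last by rewrite inE.
by rewrite big_mkcondr /=; apply: eq_bigr => y _; case: (g v y).
Qed.

Lemma ecountS g X Y A B : A \subset X -> B \subset Y -> e g A B <= e g X Y.
Proof.
move=> /setIidPr sAX /setIidPr sBY; apply: (@le_trans _ _ (e g A Y)).
  rewrite -(setID Y B) sBY ecountUr ?lerDl ?ecount_ge0 //.
  by rewrite disjoint_sym disjoints_subset subsetDr.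
rewrite -(setID X A) sAX ecountUl ?lerDl ?ecount_ge0 //.
by rewrite disjoint_sym disjoints_subset subsetDr.
Qed.

Lemma ecount_subrel g g' X Y : subrel g g' -> e g X Y <= e g' X Y.
Proof.
move=> sgg; apply: ler_sum => x _; apply: ler_sum => y _.
by rewrite ler_nat; case gxy: (g x y) => //; rewrite (sgg _ _ gxy).
Qed.

Lemma ecount_le g X Y : e g X Y <= #|X|%:R * #|Y|%:R.
Proof.
rewrite -natrM /ecount; apply: (@le_trans _ _ (\sum_(x in X) \sum_(y in Y) 1)).
  by apply: ler_sum => x _; apply: ler_sum => y _; rewrite lern1 leq_b1.
by rewrite !sumr_const -mulrnA mulnC.
Qed.

Lemma ecount_Ur_le g X Y A B : Y \subset A :|: B ->
  e g X Y <= e g X A + e g X B.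
Proof.
move=> sY; apply: (@le_trans _ _ (e g X (A :|: B :\: A))).
  apply: ecountS => //; apply: (subset_trans sY).
  by apply/subsetP=> x; rewrite !inE; case: (x \in A).
rewrite ecountUr; first by rewrite lerD2l ecountS ?subsetDl.
by rewrite disjoint_sym disjoints_subset subsetDr.
Qed.

(* W is a minimal nonempty set on which e(W, W) - w(W) - kap |W|^2 is nonnegative:
   deleting a vertex, or either side of a cut, makes this quantity negative. *)
Lemma dense_core g (w : V -> R) (kap : R) (W0 : {set V}) :
    symmetric g -> irreflexive g -> (forall v, 0 < w v) -> 0 <= kap ->
    W0 != set0 ->
    \sum_(v in W0) w v + kap * #|W0|%:R ^+ 2 <= e g W0 W0 ->
  exists W : {set V}, [/\ W \subset W0, W != set0,
    \sum_(v in W) w v + kap * #|W|%:R ^+ 2 <= e g W W,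
    forall v, v \in W -> w v / 2 <= e g [set v] W &
    forall A B : {set V}, [disjoint A & B] -> A :|: B = W ->
      kap * #|A|%:R * #|B|%:R <= e g A B].
Proof.
move=> gC gI w0 k0 W00 fW0.
pose f (Z : {set V}) := e g Z Z - (\sum_(v in Z) w v + kap * #|Z|%:R ^+ 2).
pose P (Z : {set V}) := (Z != set0) && (0 <= f Z).
have [|W /minsetP[/andP[Wn0 fW] minW] sWW0] := @minset_exists V P W0.
  by rewrite /P W00 subr_ge0.
have small (Z : {set V}) : Z \subset W -> Z != W -> Z != set0 -> f Z < 0.
  move=> sZ nZ Z0; rewrite ltNge; apply/negP => fZ.
  by move/eqP: nZ; apply; apply: minW => //; rewrite /P Z0.
(* Since [f W >= 0] while proper nonempty subsets have [f < 0], this identity makes the cross term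
   positive for every cut of [W]; for a single vertex, [f [set v] <= - w v] turns it into the degree
   bound. *)
have fD (A B : {set V}) : [disjoint A & B] -> 
    f (A :|: B) = f A + f B + 2 * e g A B - 2 * kap * #|A|%:R * #|B|%:R.
  move=> dAB; rewrite /f ecountUl // !ecountUr // (@ecountC g B A) //.
  rewrite big_disjointU //= cardsU (disjoint_setI0 dAB) cards0 subn0 natrD; ring.
exists W; split=> //; first by rewrite -subr_ge0.
- move=> v vW; have [W1|Wn1] := eqVneq W [set v].
    move: fW; rewrite /f W1 cards1 big_set1 ecount1E.
    have ->: [set y in [set v] | g v y] = set0.
      by apply/setP=> y; rewrite !inE; case: eqP => // ->; rewrite gI.
    rewrite cards0; have := w0 v; lra.
  have dv : [disjoint [set v] & W :\ v] by rewrite disjoints1 !inE eqxx.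
  have Wv : W = [set v] :|: W :\ v by rewrite setD1K.
  have := fD _ _ dv; rewrite -Wv => fE.
  have Dn0 : W :\ v != set0.
    by apply: contra_neq Wn1 => D0; rewrite Wv D0 setU0.
  have : f (W :\ v) < 0.
    by apply: small => //; rewrite ?subD1set //; apply/eqP=> EW; move: vW; rewrite -EW !inE eqxx.
  have fv : f [set v] <= - w v.
    rewrite /f ecount1E cards1 big_set1.
    have ->: [set y in [set v] | g v y] = set0.
      by apply/setP=> y; rewrite !inE; case: eqP => // ->; rewrite gI.
    by rewrite cards0; lra.
  have : e g [set v] (W :\ v) <= e g [set v] W by apply: ecountS; rewrite ?subD1set.
  have : 0 <= kap * #|[set v]|%:R * #|W :\ v|%:R by rewrite !mulr_ge0.
  have := w0 v; move: fW; lra.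
- move=> A B dAB AB; have [->|A0] := eqVneq A set0.
    by rewrite cards0 mulr0 mul0r ecount_ge0.
  have [->|B0] := eqVneq B set0; first by rewrite cards0 mulr0 ecount_ge0.
  have fA : f A < 0.
    apply: small => //; first by rewrite -AB subsetUl.
    apply/eqP=> EA; case/negP: B0; rewrite -subset0 -(disjoint_setI0 dAB).
    by rewrite subsetI subxx andbT EA -AB subsetUr.
  have fB : f B < 0.
    apply: small => //; first by rewrite -AB subsetUr.
    apply/eqP=> EB; case/negP: A0; rewrite -subset0 -(disjoint_setI0 dAB).
    by rewrite subsetI subxx /= EB -AB subsetUl.
  by have := fD _ _ dAB; rewrite AB; move: fW; lra.
Qed.

(* S consists of the vertices that the search has left for good; p is its stack,
   with the top in front. *)
Lemma dfs_partition (h : rel V) (W : {set V}) (k : nat) : (k <= #|W|)%N ->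
  exists (S : {set V}) (p : seq V),
    [/\ S \subset W, #|S| = k, uniq p, {subset p <= W :\: S} &
        sorted h p /\
        forall x y, x \in S -> y \in W -> y \notin S -> y \notin p ->
          ~~ h y x].
Proof.
elim: k => [_|k IHk ltkW].
  by exists set0, [::]; rewrite sub0set cards0; split=> //; split=> // x y; rewrite inE.
have [S [p [sSW cS up sp [hp noh]]]] := IHk (ltnW ltkW).
(* Inner induction on the number of untouched vertices. A push lowers it; when the top of the stack
   has no untouched neighbour, it moves to [S], which then has [k.+1] elements. *)
have [n] := ubnP #|W :\: S :\: [set x in p]|.
elim: n => // n IHn in p up sp hp noh *; rewrite ltnS => len.
have push y : y \in W -> y \notin S -> y \notin p -> sorted h (y :: p) ->
   exists (S : {set V}) (p : seq V),
    [/\ S \subset W, #|S| = k.+1, uniq p, {subset p <= W :\: S} &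
        sorted h p /\
        forall x y, x \in S -> y \in W -> y \notin S -> y \notin p ->
          ~~ h y x].
  move=> yW yS yp hyp; apply: (IHn (y :: p)) => //=.
  - by rewrite yp.
  - by move=> z; rewrite !inE => /orP[/eqP->|/sp]; rewrite ?inE ?yS.
  - move=> x z xS zW zS; rewrite inE negb_or => /andP[_]; exact: noh.
  - apply: leq_trans len; apply: proper_card; apply/properP; split.
      by apply/subsetP=> z; rewrite !inE negb_or -!andbA => /and4P[_ -> -> ->].
    by exists y; rewrite !inE ?yW ?yS ?yp ?eqxx.
case: p up sp hp noh len push => [|x p] up sp hp noh len push.
  have /subsetPn[y yW yS] : ~~ (W \subset S).
    by apply/negP=> /subset_leq_card; rewrite cS leqNgt ltkW.
  exact: (push y).
have [/existsP[y /and4P[yW yS yp hyx]]|] :=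
  boolP [exists y, [&& y \in W, y \notin S, y \notin x :: p & h y x]].
  by apply: (push y) => //=; rewrite hyx.
rewrite negb_exists => /forallP nx.
have := sp x (mem_head _ _); rewrite inE => /andP[xS xW].
exists (x |: S), p; split.
- by rewrite subUset sub1set xW.
- by rewrite cardsU1 xS cS.
- by case/andP: up.
- move=> y yp; have := sp y (mem_behead (s := x :: p) yp).
  rewrite !inE negb_or => /andP[-> ->]; rewrite !andbT.
  by apply: contraTneq yp => ->; case/andP: up.
- split; first exact: path_sorted hp.
  move=> x' y; rewrite !inE => /orP[/eqP->|x'S] yW; rewrite negb_or; move=> /andP[yx yS] yp.
    by have := nx y; rewrite yW yS inE negb_or yx yp.
  by apply: noh => //; rewrite inE negb_or yx.
Qed.

(** Stop the search when [S] has [k] elements. There is no edge of [h] between [S] and the untouched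
    set [X], so [e(S, X) < c]. A vertex of [S] has at most [k] neighbours in [S] and on average
    fewer than [c / k] in [X]; some vertex therefore sends the rest of its degree to the stack,
    which is a path. *)
Lemma dense_path g (h : rel V) (W : {set V}) (b c : R) (k : nat) :
    symmetric g -> symmetric h -> (forall v, v \in W -> b <= e g [set v] W) ->
    (forall S X : {set V}, S \subset W -> X \subset W -> c <= e g S X ->
       exists x y, [/\ x \in S, y \in X & h x y]) ->
    (0 < k <= #|W|)%N ->
  exists p v, [/\ uniq p, sorted h p, {subset p <= W}, v \in W &
     b - k%:R - c / k%:R <= e g [set v] [set x in p]].
Proof.
move=> gC hC degW hit /andP[k0 kW].
have [S [p [sSW cS up sp [hp noh]]]] := dfs_partition h kW.
pose X := W :\: S :\: [set x in p].
have sXW : X \subset W by apply: subset_trans (subsetDl _ _) (subsetDl _ _).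
have ltc : e g S X < c.
  rewrite ltNge; apply/negP => /(hit _ _ sSW sXW)[x [y [xS]]].
  rewrite !inE => /and3P[yp yS yW]; rewrite hC.
  by apply/negP; apply: noh.
pose b' := b - k%:R - c / k%:R.
have [/exists_inP[v vS bv]|] := boolP [exists v in S, b' <= e g [set v] [set x in p]].
  exists p, v; split => //; last exact: (subsetP sSW).
  by move=> x /sp; rewrite inE => /andP[].
rewrite negb_exists_in => /forall_inP small.
have k0R : (0 : R) < k%:R by rewrite ltr0n.
have : \sum_(v in S) (e g [set v] S + e g [set v] [set x in p] + e g [set v] X)
       < \sum_(v in S) (k%:R + b') + c.
  rewrite big_split /= -(ecount_sumr g S X); apply: ler_ltD => //.
  apply: ler_sum => v vS; apply: lerD; last by rewrite ltW // ltNge small.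
  by apply: le_trans (ecount_le _ _ _) _; rewrite cards1 mul1r cS.
have le2 : \sum_(v in S) b <= \sum_(v in S) 
   (e g [set v] S + e g [set v] [set x in p] + e g [set v] X).
  apply: ler_sum => v vS; apply: le_trans (degW _ (subsetP sSW _ vS)) _.
  apply: le_trans (ecount_Ur_le g [set v] (_ : W \subset (S :|: [set x in p]) :|: X)) _.
    apply/subsetP=> z zW; rewrite !inE zW.
    by case: (z \in S); case: (z \in p).
  by rewrite lerD2r ecount_Ur_le.
move=> /(le_lt_trans le2); rewrite !sumr_const cS -(mulr_natr b) -(mulr_natr (_ + _)).
have -> : k%:R + b' = b - c / k%:R by rewrite /b'; ring.
by rewrite mulrBl divfK ?gt_eqF // subrK ltxx.
Qed.

End EdgeCount.
Arguments ecount_le {R V}.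
Arguments ecount_ge0 {R V}.
Arguments ecountC {R V}.
Arguments ecountUl {R V}.
Arguments ecountUr {R V}.
Arguments ecount_sumr {R V}.
Arguments ecount1E {R V}.
Arguments ecount_Ur_le {R V}.

(** * Covering a dense subset by long paths *)

Section PathCover.
Variables (R : archiRealFieldType) (V : finType).
Implicit Types (g : rel V) (X Y A B : {set V}).
Local Notation e := (@ecount R V).

Lemma ecountI g X Y A B :
  e g (X :&: A) (Y :&: B) = e (fun x y => [&& x \in A, y \in B & g x y]) X Y.
Proof.
rewrite /ecount (eq_bigl (fun x => (x \in X) && (x \in A))) => [|x]; last by rewrite inE.
rewrite big_mkcondr; apply: eq_bigr => x _; case: (x \in A) => /=; last first.
  by rewrite big1.
rewrite (eq_bigl (fun x => (x \in Y) && (x \in B))) => [|y]; last by rewrite inE.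
by rewrite big_mkcondr; apply: eq_bigr => y _; case: (y \in B).
Qed.

Lemma count_alternating (T : Type) (col : T -> bool) (h : rel T) (p : seq T) (b : bool) :
  (forall x y, h x y -> col x != col y) -> sorted h p ->
  (2 * count (fun x => col x == b) p <= size p + 1)%N.
Proof.
move=> hcol; have [n] := ubnP (size p).
elim: n p => // n IHn [|x [|y p]] //=; first by move=> _ _; case: (_ == _).
rewrite !ltnS => ltpn /andP[/hcol cxy hp].
have := IHn p (ltnW ltpn) (path_sorted hp).
have : ((col x == b) + (col y == b) <= 1)%N by move: cxy; clear; case: (col x) (col y) b => [] [] [].
lia.
Qed.

(** In the bipartite graph between [U] and [P], [dense_core] gives minimum degree [b] and
    [dense_path] a path containing many neighbours of one vertex [v]. These all lie on the side
    opposite to [v], and the path alternates, so it is about twice as long. The bound [2 * c] arises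
    because the edges from [S] to [X] split into two directions, one of which carries at least
    half. *)
Lemma bipartite_path g (h : rel V) (U P : {set V}) (b c : R) (k : nat) :
    symmetric g -> irreflexive g -> symmetric h -> [disjoint U & P] ->
    (U :|: P != set0) ->
    (forall S X : {set V}, S \subset U -> X \subset P -> c <= e g S X ->
       exists x y, [/\ x \in S, y \in X & h x y]) ->
    b * #|U|%:R + b * #|P|%:R <= e g U P -> (0 < k)%N -> k%:R <= b ->
  exists p, [/\ uniq p, sorted h p, {subset p <= U :|: P} &
     2 * (b - k%:R - (2 * c) / k%:R) - 1 <= (size p)%:R].
Proof.
move=> gC gI hC dUP UP0 hit dens k0 kb.
have b0 : 0 < b by apply: lt_le_trans kb; rewrite ltr0n.
pose bip x y := (x \in U) && (y \in P) || (x \in P) && (y \in U).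
have bipC : symmetric bip by move=> x y; rewrite /bip orbC andbC [X in _ || X]andbC.
pose g' x y := g x y && bip x y; pose h' x y := h x y && bip x y.
have g'C : symmetric g' by move=> x y; rewrite /g' gC bipC.
have h'C : symmetric h' by move=> x y; rewrite /h' hC bipC.
have g'I : irreflexive g' by move=> x; rewrite /g' gI.
have nUP x : x \in U -> x \notin P by move=> xU; rewrite (disjointFr dUP).
have [||W [sW W0 _ degW _]] :=
    @dense_core R V g' (fun=> 2 * b) 0 (U :|: P) g'C g'I _ (lexx _) UP0.
- by move=> _; rewrite mulr_gt0.
- rewrite mul0r addr0 big_disjointU // !sumr_const -!(mulr_natr (2 * b)).
  rewrite ecountUl // !ecountUr // (ecountC g' P U) //.
  have ->: e g' U P = e g U P.
    apply: eq_bigr => x xU; apply: eq_bigr => y yP.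
    by rewrite /g' /bip xU yP /= andbT.
  have := ecount_ge0 (R := R) g' U U; have := ecount_ge0 (R := R) g' P P.
  by move: dens; rewrite /=; lra.
have [|||p [v [up hp sp vW pv]]] := @dense_path R V g' h' W b (2 * c) k g'C h'C.
- by move=> v /degW; rewrite mulrAC divff ?mul1r // pnatr_eq0.
- move=> S X sS sX le.
  have : e g' S X <= e g (S :&: U) (X :&: P) + e g (S :&: P) (X :&: U).
    rewrite !ecountI /ecount -big_split; apply: ler_sum => x _ /=.
    rewrite -big_split; apply: ler_sum => y _ /=; rewrite -natrD ler_nat /g' /bip.
    by case: (g x y); case: (x \in U); case: (y \in P); case: (x \in P); case: (y \in U).
  move/(le_trans le) => {}le.
  have [] := leP c (e g (S :&: U) (X :&: P)) => [leUP|ltUP].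
    have [||x [y [xS yX hxy]]] := hit _ _ _ _ leUP; rewrite ?subsetIr //.
    move: xS yX; rewrite !inE => /andP[xS xU] /andP[yX yP].
    by exists x, y; split=> //; rewrite /h' /bip hxy xU yP.
  have leUP : c <= e g (X :&: U) (S :&: P) by rewrite ecountC //; lra.
  have [||x [y [xS yX hxy]]] := hit _ _ _ _ leUP; rewrite ?subsetIr //.
  move: xS yX; rewrite !inE => /andP[xS xU] /andP[yX yP].
  by exists y, x; split=> //; rewrite /h' /bip hC hxy yP xU orbT.
- have /set0Pn[v vW] := W0.
  rewrite k0 -(ler_nat R) (le_trans kb) //.
  have := degW v vW; rewrite mulrAC divff ?pnatr_eq0 // mul1r => le.
  by apply: (le_trans le); rewrite (le_trans (ecount_le _ _ _)) // cards1 mul1r.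
exists p; split => //.
- by apply: sub_sorted hp => x y /andP[].
- by move=> x /sp /(subsetP sW).
suff : 2 * e g' [set v] [set x in p] <= (size p)%:R + 1 by move: pv; lra.
pose col x := x \in U.
have := @count_alternating V col h' p (v \notin U) _ hp.
rewrite -(ler_nat R) natrM natrD; set cn := count _ _ => lecn.
apply: le_trans (lecn _); last first.
  move=> x y /andP[_ /orP[]/andP[xA yA]]; rewrite /col.
    by rewrite xA (disjointFl dUP yA).
  by rewrite (disjointFl dUP xA) yA.
rewrite ler_pM2l // ecount1E ler_nat /cn -size_filter.
rewrite -(card_uniqP _) ?filter_uniq //; apply: subset_leq_card.
apply/subsetP=> y; rewrite !inE mem_filter => /andP[yp /andP[_ /orP[]/andP[vx yx]]];
  rewrite yp andbT /col; first by rewrite vx (disjointFl dUP yx).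
by rewrite yx (disjointFl dUP vx).
Qed.

Lemma ecount_flatten g X (ps : seq (seq V)) :
  e g X [set x in flatten ps] <= \sum_(p <- ps) e g X [set x in p].
Proof.
elim: ps => [|p ps IHps].
  rewrite big_nil (_ : [set x in _] = set0); last by apply/setP=> x; rewrite !inE.
  by apply: sumr_le0 => x _; rewrite big_set0.
rewrite big_cons -(lerD2l (e g X [set x in p])) in IHps *.
apply: le_trans IHps; apply: ecount_Ur_le.
by apply/subsetP=> x; rewrite !inE mem_cat.
Qed.

(** The lower bound on the lengths keeps the number of paths bounded; the upper bound keeps each
    path much shorter than the set of uncovered vertices. *)
Definition path_family (h : rel V) (W : {set V}) (s : nat) (ps : seq (seq V)) :=
  [/\ uniq (flatten ps), {subset flatten ps <= W}, all (sorted h) ps &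
      all (fun p => s <= size p <= s.*2)%N ps].

(** A path with [s.*2.+1] vertices, one too many, is cut into two admissible paths with [s] and
    [s.+1] vertices. *)
Lemma path_family_add (h : rel V) (W : {set V}) s (p : seq V) ps : (0 < s)%N ->
  uniq p -> sorted h p -> (s <= size p <= s.*2.+1)%N ->
  {subset p <= W} -> {subset p <= [predC flatten ps]} ->
  path_family h W s ps ->
  exists ps', path_family h W s ps' /\
              size (flatten ps') = (size p + size (flatten ps))%N.
Proof.
move=> s0 up hp sp pW pps [ups sW hps sps].
have disj : ~~ has (mem p) (flatten ps).
  by apply/hasPn=> x; apply: contraL => /pps.
have [le|gt] := leqP (size p) s.*2.
  exists (p :: ps); split; last by rewrite /= size_cat.
  split=> //=; first by rewrite cat_uniq up ups disj.
  - by move=> x; rewrite mem_cat => /orP[/pW|/sW].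
  - by rewrite hp hps.
  - by rewrite le sps !andbT; case/andP: sp.
have Ep : size p = s.*2.+1 by apply/eqP; rewrite eqn_leq gt andbT; case/andP: sp.
exists (take s p :: drop s p :: ps); split; last first.
  by rewrite /= catA cat_take_drop size_cat.
split=> /=.
- by rewrite catA cat_take_drop cat_uniq up ups disj.
- by move=> x; rewrite catA cat_take_drop mem_cat => /orP[/pW|/sW].
- by rewrite take_sorted // drop_sorted.
- rewrite sps size_drop size_takel Ep -addnn; lia.
Qed.

(** Either the uncovered set [U] is dense enough to contain a further path, or almost all edges from
    [U] go to the covered set [Q], and some path of the family can be exchanged for one with one
    more vertex. *)
Lemma path_family_step g (h : rel V) (W : {set V}) (N D eps eta hh sig : R) (s k : nat)
    (ps : seq (seq V)) :
    symmetric g -> irreflexive g -> symmetric h ->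
    0 < eps < 1 -> #|W|%:R <= N -> D <= #|W|%:R -> 0 < D ->
    eta * N ^+ 2 <= eps ^+ 2 / 8 * D ^+ 2 ->
    eta * N <= eps ^+ 2 / 8 * D ->
    eta = 8 * hh -> sig = eps * hh / 32 -> 0 < sig -> 1 <= sig * N ->
    hh * N <= s%:R <= hh * N + 1 -> sig * N <= k%:R <= sig * N + 1 ->
    (forall v, v \in W -> D / 2 <= e g [set v] W) ->
    (forall X Y : {set V}, X \subset W -> Y \subset W -> sig ^+ 2 / 2 * N ^+ 2 <= e g X Y ->
       exists x y, [/\ x \in X, y \in Y & h x y]) ->
    path_family h W s ps -> (size (flatten ps))%:R < (1 - eps) * D ->
  exists ps', path_family h W s ps' /\ (size (flatten ps) < size (flatten ps'))%N.
Proof.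
move=> gC gI hC /andP[eps0 eps1] WN DW D0 etaD2 etaD etaE sigE sig0 sigN.
move=> /andP[s1 s2] /andP[k1 k2] degW hit fam small.
have hh0 : 0 < hh by move: sig0; rewrite sigE pmulr_lgt0 ?invr_gt0 // pmulr_rgt0.
have N0 : 0 < N by rewrite -(pmulr_rgt0 _ sig0) (lt_le_trans ltr01).
have hhN : 32 <= hh * N.
  by have : eps * (hh * N) <= hh * N; [rewrite ger_pMl ?ltW ?mulr_gt0|move: sigN; rewrite sigE; lra].
have s0 : (0 < s)%N by rewrite -(ltr_nat R); lra.
have k0 : (0 < k)%N by rewrite -(ltr_nat R); lra.
have [ups sW hps sps] := fam.
set Q := [set x in flatten ps]; pose U := W :\: Q.
have cQ : #|Q| = size (flatten ps) by rewrite /Q cardsE; apply/card_uniqP.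
have cU : eps * D <= #|U|%:R.
  have sQ : Q \subset W by apply/subsetP=> x; rewrite inE => /sW.
  rewrite cardsD (setIidPr sQ) natrB ?subset_leq_card // cQ; lra.
have UN : #|U|%:R <= N by apply: le_trans WN; rewrite ler_nat subset_leq_card ?subsetDl.
set c := sig ^+ 2 / 2 * N ^+ 2 in hit.
have ck : c / k%:R <= sig * N / 2.
  rewrite ler_pdivrMr ?ltr0n // /c; nra.
(* If [U] spans many edges, a dense core of [U] contains a path with at least [s] vertices; its
   first [s] vertices are added to the family. *)
have [dU|sU] := leP (eta * N ^+ 2) (e g U U).
  have U0 : U != set0.
    by apply/eqP=> E; move: cU; rewrite E cards0; nra.
  have [||W' [sW' W'0 _ degW' _]] :=
     @dense_core R V g (fun=> eta * N) 0 U gC gI _ (lexx _) U0.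
  - by move=> _; rewrite etaE; nra.
  - rewrite mul0r addr0 sumr_const -mulr_natr; apply: le_trans dU.
    by rewrite -mulrA ler_wpM2l //; nra.
  have sW'W : W' \subset W by rewrite (subset_trans sW') ?subsetDl.
  have [|||p [v [up hp spW vW' pv]]] :=
     @dense_path R V g h W' (eta * N / 2) c k gC hC.
  - by move=> v /degW'.
  - by move=> S X sS sX; apply: hit; apply: subset_trans sW'W.
  - rewrite k0 -(ler_nat R); have /set0Pn[v vW'] := W'0.
    have := le_trans (degW' v vW') (ecount_le g _ _); rewrite cards1 mul1r.
    by apply: le_trans; rewrite etaE; nra.
  have szp : (s <= size p)%N.
    rewrite -(ler_nat R).
    have := le_trans pv (ecount_le g _ _); rewrite cards1 mul1r cardsE (card_uniqP up).
    apply: le_trans; rewrite etaE; nra.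
  have [] := @path_family_add h W s (take s p) ps s0 => //.
  - exact: take_uniq.
  - exact: take_sorted.
  - by rewrite size_takel // leqnn -addnn leqW ?leq_addr.
  - by move=> x /mem_take /spW /(subsetP sW'W).
  - move=> x /mem_take /spW /(subsetP sW'); rewrite !inE => /andP[]; done.
  move=> ps' [fam' szE]; exists ps'; split=> //.
  by rewrite szE size_takel // -[X in (X < _)%N]add0n ltn_add2r.
have UQ : (1 / 2 - eps / 8) * #|U|%:R * D <= e g U Q.
  have : \sum_(v in U) (D / 2) <= e g U U + e g U Q.
    apply: (@le_trans _ _ (e g U W)).
      rewrite [leRHS]ecount_sumr; apply: ler_sum => v; rewrite inE => /andP[_ vW].
      exact: degW.
    rewrite addrC; apply: ecount_Ur_le; apply/subsetP=> x xW.
    by rewrite !inE xW andbT; case: (x \in flatten ps).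
  rewrite sumr_const -mulr_natr.
  have : eps * D * (eps * D) <= #|U|%:R * (eps * D) by rewrite ler_wpM2r // ltW // mulr_gt0.
  move: sU etaD2; clear; lra.
(* Averaging over the paths: [Q] has fewer than [(1 - eps) * D] vertices and [(1 + eps / 2) * (1 -
   eps) / 2 < 1 / 2 - eps / 8]. *)
have /hasP[P Pps dP] : has (fun p : seq V =>
    (1 + eps / 2) / 2 * #|U|%:R * (size p)%:R <= e g U [set x in p]) ps.
  apply: contraT => /hasPn nh.
  have : e g U Q <= \sum_(p <- ps) (1 + eps / 2) / 2 * #|U|%:R * (size p)%:R.
    apply: le_trans (ecount_flatten _ _ _) _.
    rewrite [leLHS]big_seq [leRHS]big_seq; apply: ler_sum => p pps; by rewrite ltW // ltNge; apply: nh.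
  rewrite -mulr_sumr -natr_sum.
  have -> : (\sum_(p <- ps) size p)%N = size (flatten ps).
    by rewrite size_flatten sumnE big_map.
  move/(le_trans UQ); move: small; set q := (size _)%:R.
  have : 0 < #|U|%:R :> R by apply: lt_le_trans cU; rewrite mulr_gt0.
  set u := #|U|%:R; move=> u0 small le.
  suff : (1 + eps / 2) / 2 * u * q < (1 / 2 - eps / 8) * u * D by lra.
  have : u * q < u * ((1 - eps) * D) by rewrite ltr_pM2l.
  have : 0 < eps * eps * (u * D) by rewrite !mulr_gt0.
  have : 0 < eps * (u * D) by rewrite !mulr_gt0.
  have : 0 < 1 + eps / 2 by lra.
  clear - le; nra.
set l := size P in dP.
have /andP[sl ls] : (s <= l <= s.*2)%N by move/allP: sps; apply.
have ls' : l%:R <= 2 * s%:R :> R by rewrite -natrM ler_nat mul2n.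
have sl' : s%:R <= l%:R :> R by rewrite ler_nat.
have perm : perm_eq (flatten ps) (P ++ flatten (rem P ps)).
  by rewrite (perm_flatten (perm_to_rem Pps)).
have uP : uniq P by move: ups; rewrite (perm_uniq perm) cat_uniq => /and3P[].
(* Lowering [eps / 2] to [eps / 4] pays for the term [b * #|P|] in the density condition, since
   [b <= eps / 8 * #|U|]; the remaining [eps / 4] still makes the new path longer than [l]. *)
pose b := (1 + eps / 4) * l%:R / 2.
pose PS := [set x in P].
have cP : #|PS| = l by rewrite cardsE; apply/card_uniqP.
have PQ x : x \in P -> x \in flatten ps by move=> xP; rewrite (perm_mem perm) mem_cat xP.
have dUP : [disjoint U & PS].
  by rewrite disjoint_sym disjoints_subset; apply/subsetP=> x; rewrite !inE => /PQ ->.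
have sUW : U \subset W by apply: subsetDl.
have sPW : PS \subset W by apply/subsetP=> x; rewrite inE => /PQ/sW.
have [|||||p [up hp sp szp]] :=
  @bipartite_path g h U PS b c k gC gI hC dUP.
- by apply/set0Pn; have /card_gt0P[x] : (0 < #|PS|)%N;
    [rewrite cP (leq_trans s0) | exists x; rewrite inE orbC; apply/orP; left].
- by move=> S X sS sX; apply: hit; [apply: subset_trans sUW|apply: subset_trans sPW].
- rewrite cP; apply: le_trans dP; rewrite /b.
  have bU : (1 + eps / 4) * l%:R / 2 <= eps / 8 * #|U|%:R.
    have : eps * l%:R <= l%:R by rewrite ger_pMl ?ltr0n ?(leq_trans s0) // ltW.
    have : eps * (eps * D) <= eps * #|U|%:R by rewrite ler_wpM2l // ltW.
    by move: etaD s2 hhN ls'; rewrite etaE; clear; lra.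
  have : 0 <= l%:R :> R by apply: ler0n.
  have := ler_wpM2r (ler0n R l) bU; clear; lra.
- by [].
- have : eps * (hh * N) <= hh * N by rewrite ger_pMl ?mulr_gt0 ?ltW.
  have : 0 <= eps * l%:R by rewrite mulr_ge0 // ltW.
  by move: k2 s1 sl' hhN; rewrite /b sigE; clear; lra.
have lt : (l < size p)%N.
  rewrite -(ltr_nat R); apply: lt_le_trans szp.
  have : eps * (hh * N) <= eps * l%:R by rewrite ler_pM2l // (le_trans s1 sl').
  have : sig * N = eps * (hh * N) / 32 by rewrite sigE; ring.
  by move: ck k2 sigN; rewrite /b -mulrA; clear; lra.
have famr : path_family h W s (rem P ps).
  split.
  - by move: ups; rewrite (perm_uniq perm) cat_uniq => /and3P[].
  - by move=> x xr; apply: sW; rewrite (perm_mem perm) mem_cat xr orbT.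
  - by apply/allP=> q /mem_rem qps; apply: (allP hps).
  - by apply/allP=> q /mem_rem qps; apply: (allP sps).
(* One vertex more than [P] suffices, and [l <= s.*2] makes [l.+1] an admissible length. *)
have [] := @path_family_add h W s (take l.+1 p) (rem P ps) s0 => //.
- exact: take_uniq.
- exact: take_sorted.
- by rewrite size_takel // ltnS ls leqW.
- move=> x /mem_take /sp; rewrite inE => /orP[|]; last by move/(subsetP sPW).
  by move/(subsetP sUW).
- move=> x /mem_take /sp; rewrite !inE => /orP[/andP[nx _]|xP].
    by apply: contra nx => xr; rewrite (perm_mem perm) mem_cat xr orbT.
  by move: ups; rewrite (perm_uniq perm) cat_uniq => /and3P[_ /hasPn nh _]; apply/negP=> /nh; rewrite /= xP.
move=> ps' [fam' szE]; exists ps'; split=> //.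
by rewrite szE size_takel // (perm_size perm) size_cat -/l addSn.
Qed.
End PathCover.

(** Each application of [path_family_step] covers more vertices of [W], so the iteration from the
    empty family ends with the required cover. *)
Lemma path_cover (R : archiRealFieldType) (eps beta : R) :
    0 < eps < 1 -> 0 < beta <= 1 ->
  exists hh gam n0 : R, [/\ 0 < hh, 0 < gam &
    forall (V : finType) (g h : rel V) (W : {set V}) (N D : R),
      symmetric g -> irreflexive g -> symmetric h ->
      n0 <= N -> #|W|%:R <= N -> beta * N <= D -> D <= #|W|%:R ->
      (forall v, v \in W -> D / 2 <= ecount R g [set v] W) ->
      (forall X Y : {set V}, X \subset W -> Y \subset W ->
         gam * N ^+ 2 <= ecount R g X Y ->
         exists x y, [/\ x \in X, y \in Y & h x y]) ->
    exists ps : seq (seq V), [/\ uniq (flatten ps), {subset flatten ps <= W},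
      all (sorted h) ps, all (fun p => hh * N <= (size p)%:R) ps &
      (1 - eps) * D <= (size (flatten ps))%:R]].
Proof.
move=> eps01 /andP[beta0 beta1]; have /andP[eps0 eps1] := eps01.
(* With [D >= beta * N] this gives [eta * N ^+ 2 <= eps ^+ 2 / 8 * D ^+ 2]: spanning fewer than
   [eta * N ^+ 2] edges is negligible for a set of [eps * D] vertices with degrees at least
   [D / 2]. *)
pose eta : R := eps ^+ 2 * beta ^+ 2 / 8; pose hh := eta / 8.
pose sig := eps * hh / 32.
have eta0 : 0 < eta by rewrite divr_gt0 // mulr_gt0 ?exprn_gt0.
have hh0 : 0 < hh by rewrite divr_gt0.
have sig0 : 0 < sig by rewrite divr_gt0 // mulr_gt0.
exists hh, (sig ^+ 2 / 2), sig^-1; split => //; first by rewrite divr_gt0 ?exprn_gt0.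
move=> V g h W N D gC gI hC n0N WN DN DW degW hit.
have sigN : 1 <= sig * N by rewrite mulrC -ler_pdivrMr // mul1r.
have N0 : 0 < N by rewrite -(pmulr_rgt0 _ sig0) (lt_le_trans ltr01).
have D0 : 0 < D by apply: lt_le_trans DN; rewrite mulr_gt0.
have tr (x : R) : 0 <= x -> x <= (Num.truncn x).+1%:R <= x + 1.
  move=> x0; have /andP[le lt] := Num.Theory.truncn_itv x0.
  by rewrite ltW //= -natr1 lerD2r.
pose s := (Num.truncn (hh * N)).+1; pose k := (Num.truncn (sig * N)).+1.
have sP : hh * N <= s%:R <= hh * N + 1 by apply: tr; rewrite mulr_ge0 ?ltW.
have kP : sig * N <= k%:R <= sig * N + 1 by apply: tr; rewrite mulr_ge0 ?ltW.
suff : forall n ps, path_family h W s ps -> (#|W| - size (flatten ps) < n)%N ->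
    exists ps', path_family h W s ps' /\ (1 - eps) * D <= (size (flatten ps'))%:R.
  move=> /(_ #|W|.+1 [::])[||ps [[ups sW hps sps] le]].
  - by split=> // x; rewrite inE.
  - by rewrite ltnS leq_subr.
  exists ps; split=> //; apply/allP=> p /(allP sps)/andP[sp _].
  by case/andP: sP => /le_trans-> //; rewrite ler_nat.
elim=> // n IHn ps fam; rewrite ltnS => len.
have [lt|ge] := ltP (size (flatten ps))%:R ((1 - eps) * D); last by exists ps.
have [|||ps' [fam' lt']] := @path_family_step R V g h W N D eps eta hh sig s k ps
  gC gI hC eps01 WN DW D0 _ _ _ (erefl _) sig0 sigN sP kP degW hit fam lt.
- have : (beta * N) ^+ 2 <= D ^+ 2.
    by rewrite ler_pXn2r // ?nnegrE ltW // mulr_gt0.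
  move/(ler_wpM2l (_ : 0 <= eps ^+ 2 / 8)); rewrite ?divr_ge0 ?sqr_ge0 // => /(_ isT).
  by rewrite /eta; clear; lra.
- have : beta * (beta * N) <= D.
    by apply: le_trans DN; rewrite ger_pMl ?mulr_gt0.
  move/(ler_wpM2l (_ : 0 <= eps ^+ 2 / 8)); rewrite ?divr_ge0 ?sqr_ge0 // => /(_ isT).
  by rewrite /eta; clear; lra.
- by rewrite /hh; field.
apply: (IHn ps') => //; apply: leq_trans len.
rewrite ltn_sub2l //.
have [ups' sW' _ _] := fam'; apply: leq_trans lt' _.
rewrite -(card_uniqP ups'); apply: subset_leq_card.
by apply/subsetP=> x /sW'.
Qed.

(** * Weak regularity and reservoirs *)

Lemma sum2_indic (R : comNzRingType) (V : finType) (W S T : {set V}) (F : V -> V -> R) :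
  S \subset W -> T \subset W ->
  \sum_(x in W) \sum_(y in W) (x \in S)%:R * (y \in T)%:R * F x y =
  \sum_(x in S) \sum_(y in T) F x y.
Proof.
move=> sS sT; rewrite (big_setID S) /= (setIidPr sS) [X in _ + X]big1 ?addr0.
  apply: eq_bigr => x xS; rewrite (big_setID T) /= (setIidPr sT) [X in _ + X]big1 ?addr0.
    by apply: eq_bigr => y yT; rewrite xS yT !mul1r.
  by move=> y; rewrite !inE => /andP[/negPf-> _]; rewrite mulr0 mul0r.
by move=> x; rewrite !inE => /andP[/negPf-> _]; rewrite big1 // => y _; rewrite !mul0r.
Qed.

(** The squared Frobenius distance of the adjacency matrix from [B], the potential that decreases in
    the regularity argument. *)
Definition sqdist (R : numDomainType) (V : finType) (g : rel V) (B : V -> V -> R) (W : {set V}) : R :=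
  \sum_(x in W) \sum_(y in W) ((g x y)%:R - B x y) ^+ 2.

Lemma sqdist_ge0 (R : realDomainType) (V : finType) (g : rel V) (B : V -> V -> R) (W : {set V}) :
  0 <= sqdist g B W.
Proof. by apply: sumr_ge0 => x _; apply: sumr_ge0 => y _; apply: sqr_ge0. Qed.

(** Adding [c] on the rectangle [S] by [T] changes the distance by
    [- 2 * c * dl + c ^+ 2 * #|S| * #|T|], where [dl] is the discrepancy. Take [c] of absolute value
    [gam] and of the sign of [dl]. *)
Lemma sqdist_decrement (R : realFieldType) (V : finType) (g : rel V) (B : V -> V -> R)
    (W S T : {set V}) (gam : R) :
    0 < gam -> S \subset W -> T \subset W ->
    gam * #|W|%:R ^+ 2 < `| ecount R g S T - \sum_(x in S) \sum_(y in T) B x y | ->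
  exists c : R, sqdist g (fun x y => B x y + c * ((x \in S)%:R * (y \in T)%:R)) W <
     sqdist g B W - gam ^+ 2 * #|W|%:R ^+ 2.
Proof.
move=> gam0 sS sT; set dl := _ - _ => ltdl.
pose c := if 0 <= dl then gam else - gam; exists c.
have dlE : dl = \sum_(x in S) \sum_(y in T) ((g x y)%:R - B x y).
  by rewrite /dl -sumrB; apply: eq_bigr => x _; rewrite -sumrB.
have -> : sqdist g (fun x y => B x y + c * ((x \in S)%:R * (y \in T)%:R)) W =
    sqdist g B W + \sum_(x in S) \sum_(y in T)
      (- 2 * c * ((g x y)%:R - B x y) + c ^+ 2).
  rewrite -(sum2_indic _ sS sT) /sqdist -big_split; apply: eq_bigr => x _ /=.
  rewrite -big_split; apply: eq_bigr => y _ /=.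
  by case: (x \in S); case: (y \in T); rewrite /= ?mulr1n ?mulr0n; ring.
under eq_bigr do rewrite big_split -mulr_sumr sumr_const /=.
rewrite big_split -mulr_sumr -dlE sumr_const /= -mulrnA -(mulr_natr (c ^+ 2)) natrM.
have cdl : c * dl = gam * `|dl|.
  by rewrite /c; case: (leP 0 dl) => [/ger0_norm->|/ltr0_norm->] //; rewrite mulrN mulNr.
have c2 : c ^+ 2 = gam ^+ 2 by rewrite /c; case: ifP => _; rewrite ?sqrrN.
have ST : #|T|%:R * #|S|%:R <= #|W|%:R ^+ 2 :> R.
  by rewrite expr2 -!natrM ler_nat leq_mul ?subset_leq_card.
have := ler_wpM2l (sqr_ge0 gam) ST.
have : gam * (gam * #|W|%:R ^+ 2) < gam * `|dl| by rewrite ltr_pM2l.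
by rewrite -mulrA cdl c2; clear; lra.
Qed.

(** The weak regularity lemma of Frieze and Kannan, stated with a step matrix [B] that depends only
    on the labels [t]. The bound [k] does not depend on the graph. *)
Lemma weak_regularity (R : archiRealFieldType) (gam : R) : 0 < gam ->
  exists k : nat, forall (V : finType) (g : rel V) (W : {set V}),
  exists (K : finType) (t : V -> K) (B : V -> V -> R),
    [/\ (#|K| <= k)%N,
     forall x y x' y', t x = t x' -> t y = t y' -> B x y = B x' y' &
     forall S T : {set V}, S \subset W -> T \subset W ->
       `| ecount R g S T - \sum_(x in S) \sum_(y in T) B x y |
         <= gam * #|W|%:R ^+ 2].
Proof.
move=> gam0; pose n := (Num.truncn (gam ^- 2)).+1.
have nP : 1 <= n%:R * gam ^+ 2.
  have gi0 : 0 < gam ^- 2 by rewrite invr_gt0 exprn_gt0.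
  have /andP[_ lt] := Num.Theory.truncn_itv (ltW gi0).
  by rewrite -ler_pdivrMr ?exprn_gt0 // div1r ltW.
exists (4 ^ n)%N => V g W; set good := (X in exists K t B, X K t B).
(* Here [m] bounds the number of corrections still possible. The start is [B = 0] with a single
   label, at distance at most [#|W| ^ 2 <= n * gam ^ 2 * #|W| ^ 2]. *)
suff : forall m (K : finType) (t : V -> K) (B : V -> V -> R),
    (m <= n)%N -> (#|K| <= 4 ^ (n - m))%N ->
    (forall x y x' y', t x = t x' -> t y = t y' -> B x y = B x' y') ->
    sqdist g B W <= m%:R * (gam ^+ 2 * #|W|%:R ^+ 2) ->
  exists (K : finType) (t : V -> K) (B : V -> V -> R), good K t B.
  move=> /(_ n unit (fun=> tt) (fun _ _ => 0) (leqnn n)).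
  rewrite subnn card_unit; apply=> //.
  apply: (@le_trans _ _ (#|W|%:R ^+ 2)); last by rewrite mulrA ler_peMl ?sqr_ge0.
  apply: le_trans (_ : ecount R g W W <= _); last by rewrite expr2 ecount_le.
  apply: ler_sum => x _; apply: ler_sum => y _; rewrite subr0.
  by case: (g x y); rewrite /= ?mulr1n ?mulr0n ?expr1n ?expr0n.
elim=> [|m IHm] K t B mn cK tB errB;
  have [/forallP all_ok|] := boolP [forall S : {set V}, forall T : {set V},
    (S \subset W) ==> (T \subset W) ==> (`| ecount R g S T - \sum_(x in S) \sum_(y in T) B x y |
         <= gam * #|W|%:R ^+ 2)].
- exists K, t, B; split=> //.
  by move=> S T sS sT; have /forallP/(_ T) := all_ok S; rewrite sS sT.
- rewrite negb_forall => /existsP[S]; rewrite negb_forall => /existsP[T].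
  rewrite !negb_imply -ltNge => /and3P[sS sT /(sqdist_decrement gam0 sS sT)[c]].
  move=> /(le_lt_trans (sqdist_ge0 _ _ _)) lt0; exfalso.
  have : 0 <= gam ^+ 2 * #|W|%:R ^+ 2 by rewrite mulr_ge0 ?sqr_ge0.
  by move: lt0 errB; clear; lra.
- exists K, t, B; split=> //; first by apply: leq_trans cK _; rewrite leq_exp2l // leq_subr.
  by move=> S T sS sT; have /forallP/(_ T) := all_ok S; rewrite sS sT.
rewrite negb_forall => /existsP[S]; rewrite negb_forall => /existsP[T].
rewrite !negb_imply -ltNge => /and3P[sS sT /(sqdist_decrement gam0 sS sT)[c lt]].
(* The corrected matrix is constant on the labels refined by membership in [S] and in [T], which
   costs a factor 4. *)
apply: (IHm (K * bool * bool)%type (fun x => (t x, x \in S, x \in T)) _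
  (ltnW mn) _ _ (ltW (lt_le_trans lt _))).
- rewrite !card_prod card_bool -mulnA; apply: leq_trans (leq_mul cK (leqnn _)) _.
  by rewrite -expnSr subnSK.
- by move=> x y x' y' [tx -> _] [ty _ ->]; rewrite (tB _ _ _ _ tx ty).
- by move: errB; rewrite -natr1; clear; lra.
Qed.

Section Blocks.
Variables (V K : finType) (t : V -> K) (W : {set V}) (q : nat).
Hypothesis q0 : (0 < q)%N.

Definition block_family (bs : seq (seq V)) :=
  [/\ uniq (flatten bs), {subset flatten bs <= W}, {in bs, forall b, size b = q} &
      {in bs, forall b, {in b &, forall x y, t x = t y}}].

(** Greedy choice: while more than [q * #|K|] vertices are left over, some label occurs on [q] of
    them, and these form a new block. *)
Lemma block_family_exists :
  exists bs, block_family bs /\ (#|W| <= size (flatten bs) + q * #|K|)%N.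
Proof.
suff : forall n bs, block_family bs -> (#|W| - size (flatten bs) < n)%N ->
  exists bs, block_family bs /\ (#|W| <= size (flatten bs) + q * #|K|)%N.
  move=> /(_ #|W|.+1 [::]); apply; last by rewrite ltnS leq_subr.
  by split=> // x; rewrite inE.
elim=> // n IHn bs fam; rewrite ltnS => len.
have [le|gt] := leqP #|W| (size (flatten bs) + q * #|K|); first by exists bs.
have [ubs bsW sbs tbs] := fam.
pose F (c : K) := [seq x <- enum W | (x \notin flatten bs) && (t x == c)].
have /existsP[c qc] : [exists c, (q <= size (F c))%N].
  apply: contraTT gt; rewrite negb_exists => /forallP small; rewrite -leqNgt.
  have -> : #|W| = (size (flatten bs) + \sum_c size (F c))%N.
    have uW : uniq (flatten bs ++ [seq x <- enum W | x \notin flatten bs]).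
      rewrite cat_uniq ubs filter_uniq ?enum_uniq // andbT.
      by apply/hasPn=> x; rewrite mem_filter => /andP[].
    rewrite -(_ : #|[set x in flatten bs ++ [seq x <- enum W | x \notin flatten bs]]| = #|W|).
      rewrite cardsE (card_uniqP uW) size_cat; congr (_ + _)%N.
      rewrite -[LHS]sum1_size (partition_big t xpredT) //=; apply: eq_bigr => c _.
      rewrite sum1_count -size_filter -filter_predI; congr size.
      by apply: eq_filter => x /=; rewrite andbC.
    apply: eq_card => x; rewrite inE mem_cat mem_filter mem_enum.
    by case xf: (x \in flatten bs) => //=; rewrite (bsW _ xf).
  rewrite leq_add2l mulnC -sum_nat_const; apply: leq_sum => c _.
  by rewrite ltnW // ltnNge small.
pose b := take q (F c).
have bF x : x \in b -> [/\ x \in W, x \notin flatten bs & t x = c].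
  by move/mem_take; rewrite mem_filter mem_enum => /andP[/andP[? /eqP ?] ?].
have sb : size b = q by rewrite size_takel.
have famb : block_family (b :: bs).
  split=> /=.
  - have ub : uniq b by rewrite take_uniq // filter_uniq // enum_uniq.
    rewrite cat_uniq ubs ub andbT /=.
    by apply/hasPn=> x xbs; apply/negP=> /bF[_]; rewrite xbs.
  - by move=> x; rewrite mem_cat => /orP[/bF[]|/bsW].
  - by move=> b'; rewrite inE => /orP[/eqP->|/sbs].
  - move=> b'; rewrite inE => /orP[/eqP->|/tbs] // x y /bF[_ _ ->] /bF[_ _ ->] //.
apply: (IHn (b :: bs) famb); apply: leq_trans len; rewrite /= size_cat sb.
by rewrite ltn_sub2l ?(leq_ltn_trans _ gt) ?leq_addr // -[X in (X < _)%N]add0n ltn_add2r.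
Qed.

Variables (bs : seq (seq V)) (x0 : V).
Hypothesis fam : block_family bs.

Definition reps j : seq V := [seq nth x0 b j | b <- bs].
Definition blowup j (A : {set V}) : {set V} :=
  [set x in flatten [seq b <- bs | nth x0 b j \in A]].

Lemma rep_mem j b : (j < q)%N -> b \in bs -> nth x0 b j \in b.
Proof. by move=> jq bbs; apply: mem_nth; case: fam => _ _ -> . Qed.

Lemma reps_uniq j : (j < q)%N -> uniq (reps j).
Proof.
move=> jq; rewrite /reps; case: fam => + _ sb _; elim: (bs) sb => //= b l IHl sb.
rewrite cat_uniq => /and3P[ub nbl ul].
rewrite IHl // ?andbT; last by move=> b' b'l; apply: sb; rewrite inE b'l orbT.
apply: contra nbl => /mapP[b' b'l E]; apply/hasP; exists (nth x0 b j); last first.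
  by apply: mem_nth; rewrite sb ?mem_head.
by rewrite E; apply/flattenP; exists b' => //; apply: mem_nth; rewrite sb ?inE ?b'l ?orbT.
Qed.

(** A block lies in one part, on which [f] is constant, so its sum is [q] times the value at its
    [j]-th vertex. *)
Lemma sum_blowup (R : nzRingType) j (A : {set V}) (f : V -> R) : (j < q)%N ->
  {subset A <= reps j} -> (forall x y, t x = t y -> f x = f y) ->
  \sum_(x in blowup j A) f x = q%:R * \sum_(x in A) f x.
Proof.
move=> jq sA ft; case: (fam) => ubs _ sb tb.
have uf : uniq (flatten [seq b <- bs | nth x0 b j \in A]).
  elim: (bs) ubs => //= b l IHl; rewrite cat_uniq => /and3P[ub nbl ul].
  case: ifP => _ /=; last exact: IHl.
  rewrite cat_uniq ub IHl // andbT; apply: contra nbl => /hasP[x /flattenP[b' ]].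
  rewrite mem_filter => /andP[_ b'l] xb' xb; apply/hasP; exists x => //.
  by apply/flattenP; exists b'.
rewrite (eq_bigl (mem (flatten [seq b <- bs | nth x0 b j \in A]))) => [|x]; last by rewrite inE.
rewrite -big_uniq //= big_flatten big_filter big_seq_cond /=.
have -> : \sum_(x in A) f x = \sum_(x <- reps j | x \in A) f x.
  rewrite -[RHS]big_filter [RHS]big_uniq /= ?filter_uniq ?reps_uniq //.
  apply: eq_bigl => x; rewrite mem_filter.
  by case xA: (x \in A) => //=; rewrite sA.
rewrite big_map mulr_sumr [RHS]big_seq_cond; apply: eq_bigr => b /andP[bbs _].
rewrite big_seq (eq_bigr (fun=> f (nth x0 b j))) => [|x xb].
  rewrite -big_seq big_const_seq count_predT sb //.
  by rewrite iter_addr_0 mulr_natl.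
by apply: ft; apply: (tb b bbs x _ xb (rep_mem jq bbs)).
Qed.

End Blocks.

Lemma uniq_flatten_inj (T : eqType) (ss : seq (seq T)) s1 s2 x :
  uniq (flatten ss) -> s1 \in ss -> s2 \in ss -> x \in s1 -> x \in s2 -> s1 = s2.
Proof.
elim: ss => //= s ss IHss; rewrite cat_uniq => /and3P[_ /hasPn ns us].
have nx s' : s' \in ss -> x \in s' -> x \in s -> False.
  by move=> s'ss xs' xs; have := ns x; rewrite /= xs => /(_ _)/negP; apply=> //;
     apply/flattenP; exists s'.
rewrite !inE => /predU1P[->|s1ss] /predU1P[->|s2ss] // xs1 xs2.
- by case: (nx s2).
- by case: (nx s1).
exact: IHss.
Qed.

(* Partition W, up to a few vertices, into blocks of q vertices of the same part of
   a weakly regular partition; the i-th reservoir collects the i-th vertices of the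
   blocks. A cut of the reservoir extends to a cut of W constant on each block, whose
   density is the same up to the regularity error. *)
Lemma reservoirs (R : archiRealFieldType) (kap mu zeta eta : R) (q : nat) :
    0 < kap -> 0 < mu -> 0 < zeta -> 0 < eta -> (0 < q)%N ->
  exists n0 : R, forall (V : finType) (g : rel V) (W : {set V}) (N : R),
    symmetric g -> n0 <= N -> 0 < N -> W != set0 -> #|W|%:R <= N ->
    (forall v, v \in W -> mu * N <= ecount R g [set v] W) ->
    (forall A B : {set V}, [disjoint A & B] -> A :|: B = W ->
       kap * #|A|%:R * #|B|%:R <= ecount R g A B) ->
  exists Rs : nat -> {set V}, 
    [/\ forall i, (i < q)%N -> [/\ Rs i \subset W, (q * #|Rs i| <= #|W|)%N &
          #|W|%:R - mu / 2 * N <= q%:R * #|Rs i|%:R],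
        forall i j, (i < q)%N -> (j < q)%N -> i != j -> [disjoint Rs i & Rs j],
        forall i (X : {set V}), (i < q)%N -> X \subset W -> zeta * N <= #|X|%:R ->
          zeta * mu / (4 * q%:R) * N ^+ 2 <= ecount R g X (Rs i) &
        forall i (A B : {set V}), (i < q)%N -> [disjoint A & B] -> A :|: B = Rs i ->
          eta * N <= #|A|%:R -> eta * N <= #|B|%:R ->
          kap * eta ^+ 2 / 2 * N ^+ 2 <= ecount R g A B].
Proof.
move=> kap0 mu0 zeta0 eta0 q0.
have qR : (0 : R) < q%:R by rewrite ltr0n.
have q1 : (1 : R) <= q%:R by rewrite ler1n.
(* The regularity error has to be small against both densities claimed for the reservoirs. *)
pose gam := Order.min (kap * eta ^+ 2 / 8) (zeta * mu / (8 * q%:R)).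
have gam0 : 0 < gam by rewrite lt_min !divr_gt0 ?mulr_gt0 ?exprn_gt0.
have gamle1 : gam <= kap * eta ^+ 2 / 8 by rewrite ge_min lexx.
have gamle2 : gam <= zeta * mu / (8 * q%:R) by rewrite ge_min lexx orbT.
have [k FK] := weak_regularity gam0.
(* At most [q * k] vertices lie in no block; the two thresholds make them negligible for degrees and
   for cuts, respectively. *)
exists (Order.max (2 * q%:R * k%:R / mu) (4 * k%:R / (q%:R * (kap * eta ^+ 2)))).
move=> V g W N gC; rewrite ge_max => /andP[n1 n2] N0 Wn0 WN degW cutW.
have {}n1 : q%:R * k%:R <= mu / 2 * N.
  by move: n1; rewrite ler_pdivrMr //; clear; lra.
have {}n2 : 4 * k%:R <= q%:R * (kap * eta ^+ 2) * N.
  by move: n2; rewrite ler_pdivrMr ?mulr_gt0 ?exprn_gt0 //; clear; lra.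
have [K [t [B [cK tB FKW]]]] := FK V g W.
have W2 : #|W|%:R ^+ 2 <= N ^+ 2 :> R by rewrite ler_pXn2r // ?nnegrE // ltW.
have {}FKW (S T : {set V}) : S \subset W -> T \subset W ->
    ecount R g S T - gam * N ^+ 2 <= \sum_(x in S) \sum_(y in T) B x y
      <= ecount R g S T + gam * N ^+ 2.
  move=> sS sT; have := le_trans (FKW S T sS sT) (ler_wpM2l (ltW gam0) W2).
  by rewrite ler_norml; clear; lra.
have /set0Pn[x0 _] := Wn0.
have [bs [fam lenbs]] := block_family_exists t W q0.
have [ubs bsW sb tb] := fam.
pose W' := [set x in flatten bs].
have sW' : W' \subset W by apply/subsetP=> x; rewrite inE; apply: bsW.
have cW' : #|W'| = size (flatten bs) by rewrite cardsE; apply/card_uniqP.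
have szf : size (flatten bs) = (q * size bs)%N.
  rewrite size_flatten; elim: (bs) sb => [|b l IHl] sb' /=; first by rewrite muln0.
  by rewrite sb' ?mem_head // IHl ?mulnS // => b' b'l; rewrite sb' // inE b'l orbT.
pose Rs j := [set x in reps bs x0 j].
have RsE j : (j < q)%N -> #|Rs j| = size bs.
  by move=> jq; rewrite cardsE (card_uniqP (reps_uniq x0 fam jq)) size_map.
have RsW j : (j < q)%N -> Rs j \subset W.
  move=> jq; apply/subsetP=> x; rewrite inE => /mapP[b bbs ->]; apply: bsW.
  by apply/flattenP; exists b => //; exact: (rep_mem x0 fam jq bbs).
have left_small : #|W :\: W'|%:R <= mu / 2 * N.
  apply: le_trans n1; rewrite -natrM ler_nat cardsD (setIidPr sW') cW'.
  by rewrite leq_subLR (leq_trans lenbs) // leq_add2l leq_mul2l cK orbT.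
have left_small2 : 4 * #|W :\: W'|%:R <= q%:R ^+ 2 * (kap * eta ^+ 2) * N.
  have : #|W :\: W'|%:R <= q%:R * k%:R :> R.
    rewrite -natrM ler_nat cardsD (setIidPr sW') cW'.
    by rewrite leq_subLR (leq_trans lenbs) // leq_add2l leq_mul2l cK orbT.
  have := ler_wpM2l (ltW qR) n2; clear; lra.
have bW j A : (j < q)%N -> blowup bs x0 j A \subset W.
  move=> jq; apply/subsetP=> x; rewrite inE => /flattenP[b]; rewrite mem_filter => /andP[_ bbs] xb.
  by apply: bsW; apply/flattenP; exists b.
have card_blow j (A : {set V}) : (j < q)%N -> A \subset Rs j -> #|blowup bs x0 j A|%:R = q%:R * #|A|%:R :> R.
  move=> jq sA; have := @sum_blowup V K t W q bs x0 fam R j A (fun=> 1) jq.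
  rewrite !sumr_const; apply=> //.
  by move=> x /(subsetP sA); rewrite inE.
exists Rs; split.
- move=> i iq; split; [exact: RsW| |].
    by rewrite RsE // -szf -cW' subset_leq_card.
  rewrite RsE // -natrM -szf -cW'; move: left_small; rewrite cardsD (setIidPr sW').
  by rewrite natrB ?subset_leq_card //; clear; lra.
- move=> i j iq jq nij; rewrite -setI_eq0; apply/eqP/setP=> x; rewrite !inE.
  apply/negP=> /andP[/mapP[b bbs ->] /mapP[b' b'bs E]].
  have Eb : b = b'.
    apply: (uniq_flatten_inj ubs bbs b'bs (rep_mem x0 fam iq bbs)).
    by rewrite E; exact: (rep_mem x0 fam jq b'bs).
  move/eqP: E; rewrite -Eb nth_uniq ?sb //; first by apply/negP.
  have : subseq b (flatten bs).
    elim: (bs) bbs => //= c l IHl; rewrite inE => /predU1P[->|/IHl sub].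
      exact: prefix_subseq.
    exact: subseq_trans sub (suffix_subseq _ _).
  by move/subseq_uniq; apply.
- move=> i X iq sX cX.
  have sXR := FKW X (Rs i) sX (RsW i iq).
  have sXW := FKW X W' sX sW'.
  (* For the step matrix, the reservoir sees exactly the fraction [1 / q] of what [X] sends to the
     blocks; regularity transfers this to edges. *)
  have E : \sum_(x in X) \sum_(y in W') B x y = q%:R * \sum_(x in X) \sum_(y in Rs i) B x y.
    rewrite mulr_sumr; apply: eq_bigr => x _.
    rewrite -(@sum_blowup V K t W q bs x0 fam R i (Rs i) (B x) iq) //; last 2 first.
    - by move=> y; rewrite inE.
    - by move=> y z E; apply: tB.
    apply: eq_bigl => y; rewrite !inE; congr (y \in flatten _).
    rewrite (@eq_in_filter _ _ predT) ?filter_predT // => b bbs /=.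
    by rewrite inE; apply/mapP; exists b.
  have eXW : zeta * mu / 2 * N ^+ 2 <= ecount R g X W'.
    have : \sum_(x in X) (mu * N) <= ecount R g X W' + ecount R g X (W :\: W').
      apply: (@le_trans _ _ (ecount R g X W)).
        by rewrite [leRHS]ecount_sumr; apply: ler_sum => v /(subsetP sX)/degW.
      apply: ecount_Ur_le; apply/subsetP=> x xW; rewrite !inE xW andbT.
      by case: (x \in flatten bs).
    rewrite sumr_const -mulr_natr.
    have := ecount_le g X (W :\: W') : _ <= _ :> R.
    have := ler_wpM2l (ler0n R #|X|) left_small.
    have := ler_wpM2r (ltW (mulr_gt0 mu0 N0)) cX; clear; lra.
  have gN : q%:R * (gam * N ^+ 2) <= zeta * mu / 8 * N ^+ 2.
    rewrite mulrA ler_wpM2r ?sqr_ge0 //.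
    apply: le_trans (ler_wpM2l (ltW qR) gamle2) _.
    by rewrite le_eqVlt; apply/orP; left; apply/eqP; field; rewrite gt_eqF.
  have gN' : gam * N ^+ 2 <= q%:R * (gam * N ^+ 2).
    by rewrite ler_peMl // mulr_ge0 ?sqr_ge0 // ltW.
  rewrite -(ler_pM2l qR).
  have -> : q%:R * (zeta * mu / (4 * q%:R) * N ^+ 2) = zeta * mu / 4 * N ^+ 2.
    by field; rewrite gt_eqF.
  case/andP: sXR => _ sXR; case/andP: sXW => sXW _.
  have := ler_wpM2l (ltW qR) sXR; rewrite -E.
  by move: sXW eXW gN gN'; clear; lra.
- move=> i A A' iq dAA' AA' cA cA'.
  have sA : A \subset Rs i by rewrite -AA' subsetUl.
  have sA' : A' \subset Rs i by rewrite -AA' subsetUr.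
  set Ab := blowup bs x0 i A; set Ab' := blowup bs x0 i A'.
  have sAb : Ab \subset W by apply: bW.
  have sAb' : Ab' \subset W by apply: bW.
  have /andP[_ le1] := FKW A A' (subset_trans sA (RsW i iq)) (subset_trans sA' (RsW i iq)).
  have /andP[le2 _] := FKW Ab Ab' sAb sAb'.
  have E : \sum_(x in Ab) \sum_(y in Ab') B x y = q%:R ^+ 2 * \sum_(x in A) \sum_(y in A') B x y.
    rewrite (@sum_blowup V K t W q bs x0 fam R i A) //; last 2 first.
    - by move=> y /(subsetP sA); rewrite inE.
    - by move=> y z yz; apply: eq_bigr => u _; apply: tB.
    rewrite expr2 -mulrA; congr (_ * _); rewrite mulr_sumr; apply: eq_bigr => x _.
    rewrite (@sum_blowup V K t W q bs x0 fam R i A') //.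
    - by move=> y /(subsetP sA'); rewrite inE.
    - by move=> y z yz; apply: tB.
  have cAb : #|Ab|%:R = q%:R * #|A|%:R :> R by apply: card_blow.
  (* The cut hypothesis applies to [Ab] and its complement in [W], which is [Ab'] together with the
     leftover vertices. The latter cost at most a quarter of the density and the two regularity
     errors an eighth each, so half remains. *)
  have cut : kap * #|Ab|%:R * #|W :\: Ab|%:R <= ecount R g Ab (W :\: Ab).
    apply: cutW; first by rewrite disjoint_sym disjoints_subset subsetDr.
    by rewrite -{1}(setIidPr sAb) setID.
  have cWAb : q%:R * #|A'|%:R <= #|W :\: Ab|%:R :> R.
    rewrite cardsD (setIidPr sAb) natrB ?subset_leq_card // cAb.
    rewrite lerBrDl -mulrDr -natrD.
    have -> : (#|A| + #|A'|)%N = #|Rs i|.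
      by rewrite -AA' cardsU (disjoint_setI0 dAA') cards0 subn0.
    by rewrite RsE // -natrM -szf -cW' ler_nat subset_leq_card.
  have eAb : ecount R g Ab (W :\: Ab) <= ecount R g Ab Ab' + ecount R g Ab (W :\: W').
    apply: ecount_Ur_le; apply/subsetP=> x; rewrite !inE => /andP[nx xW].
    rewrite xW andbT; case xf: (x \in flatten bs); last by rewrite orbT.
    have /flattenP[b bbs xb] := xf; rewrite orbF.
    apply/flattenP; exists b => //; rewrite mem_filter bbs andbT.
    have : nth x0 b i \in Rs i by rewrite inE; apply/mapP; exists b.
    rewrite -AA' inE => /orP[repA|] //; case/negP: nx.
    by apply/flattenP; exists b => //; rewrite mem_filter repA.
  have eAl : 4 * ecount R g Ab (W :\: W') <= q%:R ^+ 2 * (kap * eta ^+ 2) * N ^+ 2.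
    apply: le_trans (ler_wpM2l (ler0n R 4) (ecount_le _ _ _)) _.
    have cAbN : #|Ab|%:R <= N by apply: le_trans WN; rewrite ler_nat subset_leq_card.
    have := ler_wpM2l (ler0n R #|W :\: W'|) cAbN.
    have := ler_wpM2r (ltW N0) left_small2; clear; lra.
  have cutN : kap * (q%:R ^+ 2 * (eta ^+ 2 * N ^+ 2)) <= ecount R g Ab (W :\: Ab).
    apply: le_trans cut; rewrite -mulrA ler_pM2l //.
    have -> : q%:R ^+ 2 * (eta ^+ 2 * N ^+ 2) = (q%:R * (eta * N)) * (q%:R * (eta * N)) by ring.
    have p0 : 0 <= q%:R * (eta * N) by rewrite !mulr_ge0 // ltW.
    apply: ler_pM => //; first by rewrite cAb ler_pM2l.
    by apply: le_trans cWAb; rewrite ler_pM2l.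
  have gN : gam * N ^+ 2 <= q%:R ^+ 2 * (gam * N ^+ 2).
    by apply: ler_peMl; rewrite ?exprn_ege1 // mulr_ge0 ?sqr_ge0 // ltW.
  have gN' : q%:R ^+ 2 * (gam * N ^+ 2) <= q%:R ^+ 2 * (kap * eta ^+ 2 / 8 * N ^+ 2).
    by rewrite ler_wpM2l ?sqr_ge0 // ler_wpM2r ?sqr_ge0.
  have q2 : (0 : R) < q%:R ^+ 2 by rewrite exprn_gt0.
  rewrite -(ler_pM2l q2).
  have := ler_wpM2l (ltW q2) le1; move: le2; rewrite E.
  move: eAb eAl cutN gN gN'; clear; lra.
Qed.

(** * Linking paths into a cycle *)

Section Linking.
Variables (V : finType) (h : rel V).
Hypothesis hC : symmetric h.
Implicit Types (A B C W : {set V}).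

(** The connecting paths are simple and stay inside [C], so that they can be inserted into a path
    disjoint from [C]. *)
Definition connected_set C := forall x y, x \in C -> y \in C ->
  exists p, [/\ path h x p, last x p = y, uniq (x :: p) & {subset x :: p <= C}].

(* C is a minimal union of components of h on Z with at least m vertices. *)
Lemma giant_component (R : realFieldType) (Z : {set V}) (m : R) :
    0 < m -> 3 * m <= #|Z|%:R ->
    (forall A B, [disjoint A & B] -> A :|: B = Z -> m <= #|A|%:R -> m <= #|B|%:R ->
      exists x y, [/\ x \in A, y \in B & h x y]) ->
  exists C, [/\ C \subset Z, #|Z :\: C|%:R < m & connected_set C].
Proof.
move=> m0 m3 edge.
pose closed A := [forall x in A, forall y in Z, h x y ==> (y \in A)].
pose P A := [&& A \subset Z, m <= #|A|%:R & closed A].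
have PZ : P Z.
  rewrite /P subxx /=; apply/andP; split; first by lra.
  by apply/forall_inP=> x xZ; apply/forall_inP=> y yZ; rewrite yZ implybT.
have [C /minsetP[/and3P[sC mC clC] minC] _] := @minset_exists V P Z PZ.
(* No edge of [h] leaves a closed set inside [Z], so one side of this cut must be too small for
   [edge] to apply. *)
have cut A : A \subset Z -> closed A -> #|Z :\: A|%:R < m \/ #|A|%:R < m.
  move=> sA clA; have [mA|] := leP m #|A|%:R; last by right.
  have [mZA|] := leP m #|Z :\: A|%:R; last by left.
  have [||x [y [xA]]] := edge A (Z :\: A) _ _ mA mZA.
  - by rewrite disjoint_sym disjoints_subset subsetDr.
  - by rewrite -{1}(setIidPr sA) setID.
  rewrite inE => /andP[/negP nyA yZ] hxy; case: nyA.
  by move/forall_inP: clA => /(_ x xA)/forall_inP/(_ y yZ); rewrite hxy.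
have ZC : #|Z :\: C|%:R < m.
  by case: (cut C sC clC) => // /(le_lt_trans mC); rewrite ltxx.
exists C; split=> // x y xC yC.
pose hC' u v := [&& h u v, u \in Z & v \in Z].
have hC'C : symmetric hC' by move=> u v; rewrite /hC' hC [X in _ && X]andbC.
pose Cx := [set z | connect hC' x z].
have step z u : z \in C -> connect hC' z u -> u \in C.
  move=> zC /connectP[p]; elim: p z zC => [|v p IHp] z zC /=; first by move=> _ ->.
  case/andP=> /and3P[hzv zZ vZ] hp E; apply: (IHp v _ hp E).
  by move/forall_inP: clC => /(_ z zC)/forall_inP/(_ v vZ); rewrite hzv.
have sCx : Cx \subset C by apply/subsetP=> z; rewrite inE; apply: (step x).
have clCx : closed Cx.
  apply/forall_inP=> u; rewrite inE => xu; apply/forall_inP=> v vZ; apply/implyP=> huv.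
  rewrite inE; apply: (connect_trans xu); apply: connect1; rewrite /hC' huv vZ.
  by rewrite (subsetP sC _ (step _ _ xC xu)).
have xCx : x \in Cx by rewrite inE connect0.
(* Otherwise minimality of [C] makes both the component of [x] and the rest of [C] smaller than [m];
   with the fewer than [m] vertices outside [C] this gives [#|Z| < 3 * m]. *)
have yCx : y \in Cx.
  apply: contraT => ny.
  have lt1 : #|Cx|%:R < m.
    rewrite ltNge; apply/negP=> mCx.
    have := minC Cx; rewrite /P (subset_trans sCx sC) mCx clCx => /(_ isT sCx) E.
    by rewrite E yC in ny.
  have lt2 : #|C :\: Cx|%:R < m.
    rewrite ltNge; apply/negP=> mCx.
    have := minC (C :\: Cx); rewrite /P (subset_trans (subsetDl _ _) sC) mCx subsetDl.
    have -> : closed (C :\: Cx).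
      apply/forall_inP=> u; rewrite !inE => /andP[nxu uC]; apply/forall_inP=> v vZ.
      apply/implyP=> huv; rewrite !inE.
      have -> : v \in C by move/forall_inP: clC => /(_ u uC)/forall_inP/(_ v vZ); rewrite huv.
      rewrite andbT; apply: contra nxu => xv; apply: connect_trans xv _; apply: connect1.
      by rewrite /hC' hC huv vZ (subsetP sC).
    by move=> /(_ isT isT) E; move: xC; rewrite -E inE xCx.
  have cC : #|C|%:R = #|Cx|%:R + #|C :\: Cx|%:R :> R.
    by rewrite -natrD -(cardsID Cx C) (setIidPr sCx).
  have cZ : #|Z|%:R = #|C|%:R + #|Z :\: C|%:R :> R.
    by rewrite -natrD -(cardsID C Z) (setIidPr sC).
  by move: m3; rewrite cZ cC; lra.
have /connectP[p0 hp0 ->] : connect hC' x y by rewrite inE in yCx.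
case/shortenP: hp0 => p hp up _; exists p; split=> //.
  by apply: sub_path hp => u v /andP[].
by move=> u upth; apply: (step x _ xC); apply: (path_connect hp).
Qed.

(** Leave the first path at a vertex [y] of its end segment [Y], cross [C], and enter the second
    path at a vertex [x] of its initial segment [X]. Only vertices of [Y] after [y] and of [X]
    before [x] are lost. *)
Lemma link_paths (a Y X b : seq V) C :
    connected_set C -> sorted h (a ++ Y) -> sorted h (X ++ b) ->
    uniq (a ++ Y) -> uniq (X ++ b) ->
    {in a ++ Y, forall z, z \notin X ++ b} ->
    {in C, forall z, z \notin a ++ Y} -> {in C, forall z, z \notin X ++ b} ->
    (exists y c, [/\ y \in Y, c \in C & h y c]) ->
    (exists x c, [/\ x \in X, c \in C & h x c]) ->
  exists mid, [/\ sorted h (a ++ mid ++ b), uniq (a ++ mid ++ b) &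
    forall z, z \in mid -> [|| z \in Y, z \in X | z \in C]].
Proof.
move=> conC haY hXb uaY uXb dis dCY dCX [y [c [yY cC hyc]]] [x [c' [xX c'C hxc']]].
case/splitPr: Y / yY haY uaY dis dCY => Y1 Y2 haY uaY dis dCY.
case/splitPr: X / xX hXb uXb dis dCX => X1 X2 hXb uXb dis dCX.
have [r [hr lr ur rC]] := conC c c' cC c'C.
exists ((Y1 ++ y :: c :: r) ++ x :: X2); split.
- rewrite -!catA !cat_cons catA sorted_cat_cons /= hyc cat_path hr lr /= hC hxc'.
  move: haY hXb; rewrite catA sorted_cat_cons => /andP[-> _].
  by rewrite -catA cat_cons sorted_cat_cons => /andP[_ ->].
- have uL : uniq ((a ++ Y1) ++ [:: y]).
    by move: uaY; rewrite -cat_rcons catA cats1 -rcons_cat cat_uniq => /andP[].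
  have uR : uniq (x :: X2 ++ b).
    by move: uXb; rewrite -catA cat_cons cat_uniq => /and3P[].
  have -> : a ++ ((Y1 ++ y :: c :: r) ++ x :: X2) ++ b =
      ((a ++ Y1) ++ [:: y]) ++ (c :: r) ++ (x :: X2 ++ b) by rewrite -!catA.
  rewrite cat_uniq uL cat_uniq ur uR !(andbT, andTb); apply/andP; split; apply/hasPn=> z; last first.
    move=> zR; apply/negP=> /rC/dCX/negP; apply.
    by rewrite -catA cat_cons mem_cat zR orbT.
  move=> zz; apply/negP => zL.
  have zL' : z \in a ++ Y1 ++ y :: Y2.
    by move: zL; rewrite -catA !mem_cat !inE => /or3P[->|->|->]; rewrite ?orbT.
  move: zz; rewrite mem_cat => /orP[/rC/dCY|zR]; first by rewrite zL'.
  by have := dis z zL'; rewrite -catA cat_cons mem_cat zR orbT.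
- move=> z; rewrite !mem_cat !inE => /orP[/orP[->|/or3P[->|/eqP->|zr]]|/orP[->|->]];
    rewrite ?orbT // ?cC ?orbT //.
  by rewrite rC ?orbT // inE zr orbT.
Qed.

Lemma split_ends (l : nat) (p : seq V) : (l.*2 <= size p)%N ->
  exists X M Y, [/\ p = X ++ M ++ Y, size X = l, size Y = l & size M = (size p - l.*2)%N].
Proof.
move=> lp; exists (take l p), (take (size p - l.*2) (drop l p)), (drop (size p - l) p).
split.
- rewrite -[LHS](cat_take_drop l); congr (_ ++ _).
  rewrite -[LHS](cat_take_drop (size p - l.*2)); congr (_ ++ _).
  by rewrite drop_drop; congr drop; move: (size p) lp => n lp; lia.
- by rewrite size_takel //; move: (size p) lp => n lp; lia.
- by rewrite size_drop; move: (size p) lp => n lp; lia.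
- by rewrite size_takel // size_drop; move: (size p) lp => n lp; lia.
Qed.

(** The chain [a ++ m ++ Y] has a segment [a] reserved for closing the cycle, a secured middle [m],
    and an end [Y] at which the next path is linked through [C i]. Linking through [C i] leaves the
    later sets untouched and costs each path at most its two ends of [l] vertices. *)
Lemma link_chain (C : nat -> {set V}) (q l : nat) W :
    (forall j, (j < q)%N -> connected_set (C j)) ->
    (forall i j, (i < q)%N -> (j < q)%N -> i != j -> [disjoint C i & C j]) ->
    (forall j, (j < q)%N -> [disjoint W & C j]) ->
    (forall j (Z : seq V), (j < q)%N -> uniq Z -> {subset Z <= W} -> size Z = l ->
       exists z c, [/\ z \in Z, c \in C j & h z c]) ->
  forall ps i a m Y, (i + size ps <= q)%N -> uniq (a ++ m ++ Y) -> sorted h (a ++ m ++ Y) ->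
    {subset Y <= W} -> size Y = l ->
    (forall x j, x \in a ++ m ++ Y -> (i <= j < q)%N -> x \notin C j) ->
    uniq (flatten ps) -> all (sorted h) ps -> {subset flatten ps <= W} ->
    {in a ++ m ++ Y, forall x, x \notin flatten ps} ->
    all (fun p => l.*2 <= size p)%N ps ->
  exists m' Y', [/\ uniq (a ++ m' ++ Y'), sorted h (a ++ m' ++ Y'),
     {subset Y' <= W} /\ size Y' = l,
     forall x j, x \in a ++ m' ++ Y' -> (i + size ps <= j < q)%N -> x \notin C j &
     (size m + \sum_(p <- ps) (size p - l.*2) <= size m')%N].
Proof.
move=> conC dC dW att; elim=> [|p ps IHps] i a m Y iq uz hz YW sY dz ups hps psW dzps lps.
  exists m, Y; rewrite big_nil addn0; split=> // x j xz; rewrite addn0; exact: dz.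
have iq' : (i < q)%N by apply: leq_trans iq; rewrite /= addnS ltnS leq_addr.
move: lps hps ups => /= /andP[lp lps] /andP[hp hps]; rewrite cat_uniq => /and3P[up npps ups].
have pW : {subset p <= W} by move=> x xp; apply: psW; rewrite /= mem_cat xp.
have psW' : {subset flatten ps <= W} by move=> x xp; apply: psW; rewrite /= mem_cat xp orbT.
have [X [M [Y1 [pE sX sY1 sM]]]] := split_ends lp.
have Xp : {subset X <= p} by move=> x xX; rewrite pE mem_cat xX.
have Mp : {subset M <= p} by move=> x xM; rewrite pE !mem_cat xM !orbT.
have Y1p : {subset Y1 <= p} by move=> x xX; rewrite pE !mem_cat xX !orbT.
have [|||||||||mid [hmid umid midP]] := @link_paths (a ++ m) Y X (M ++ Y1) (C i) (conC i iq').
- by rewrite -catA.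
- by rewrite -pE.
- by rewrite -catA.
- by rewrite -pE.
- rewrite -catA -pE => x /dzps; rewrite /= mem_cat negb_or => /andP[]; done.
- move=> x xC; rewrite -catA; apply/negP => xz.
  by have := dz x i xz; rewrite leqnn iq' xC => /(_ isT).
- by move=> x xC; rewrite -pE; apply/negP=> /pW; rewrite (disjointFl (dW i iq') xC).
- by apply: att => //; move: uz; rewrite catA cat_uniq => /and3P[].
- apply: att => //; last by move=> x /Xp/pW.
  by move: up; rewrite pE cat_uniq => /andP[].
rewrite -catA in hmid umid.
have zP x : x \in a ++ (m ++ mid ++ M) ++ Y1 ->
    [|| x \in a ++ m ++ Y, x \in p | x \in C i].
  rewrite !mem_cat.
  by case/orP=> [xa|/orP[/or3P[xm|/midP/or3P[xY|/Xp xp|xC]|/Mp xp]|/Y1p xp]];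
    rewrite ?xa ?xm ?xY ?xp ?xC ?orbT.
have [|||||||||||m' [Y' [u' h' [Y'W sY'] dz' le]]] :=
  IHps i.+1 a (m ++ mid ++ M) Y1; rewrite ?addSnnS //.
- by rewrite -!catA.
- by rewrite -!catA.
- by move=> x /Y1p/pW.
- move=> x j /zP /or3P[xz|xp|xC] /andP[ij jq].
  + by apply: dz => //; rewrite ltnW.
  + by apply/negP=> xC; have := pW x xp; rewrite (disjointFl (dW j jq) xC).
  + by rewrite (disjointFr (dC i j iq' jq _) xC) // neq_ltn ij.
- move=> x /zP /or3P[/dzps|xp|xC].
  + by rewrite /= mem_cat negb_or => /andP[].
  + by apply/negP=> xps; move/hasPn: npps => /(_ x xps); rewrite /= xp.
  + by apply/negP=> /psW'; rewrite (disjointFl (dW i iq') xC).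
exists m', Y'; split=> //.
  by move=> x j xz; rewrite /= addnS -addSn; apply: dz'.
rewrite big_cons; apply: leq_trans le.
by rewrite !size_cat sM -!addnA leq_add2l leq_addl.
Qed.

(** Join a vertex of [Y] through [C] to a vertex of [a] and drop the two outer remainders; the cycle
    contains all of [m]. *)
Lemma close_chain C (a m Y : seq V) :
    connected_set C -> uniq (a ++ m ++ Y) -> sorted h (a ++ m ++ Y) ->
    {in C, forall z, z \notin a ++ m ++ Y} ->
    (exists y c, [/\ y \in Y, c \in C & h y c]) ->
    (exists x c, [/\ x \in a, c \in C & h x c]) ->
  exists s, [/\ (3 <= size s)%N, ucycle h s & (size m <= size s)%N].
Proof.
move=> conC u s dC [y [c [yY cC hyc]]] [x [c' [xa c'C hxc']]].
have [r [hr lr ur rC]] := conC c c' cC c'C.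
case/splitPr: Y / yY u s dC => Y1 Y2 u s dC.
case/splitPr: a / xa u s dC => a1 a2 u s dC.
have E : (a1 ++ x :: a2) ++ m ++ Y1 ++ y :: Y2 =
         a1 ++ (x :: a2 ++ m ++ Y1 ++ [:: y]) ++ Y2.
  by rewrite -!catA /= -!catA.
exists ((x :: a2 ++ m ++ Y1 ++ [:: y]) ++ c :: r); split.
- by rewrite !size_cat /= !size_cat /= addnS addnS ltnS addnC !addnS.
- apply/andP; split.
    rewrite /= rcons_cat cat_path /= rcons_path hr lr (hC c' x) hxc' andbT.
    have := s; rewrite E cat_cons sorted_cat_cons => /andP[_ hx].
    by move: hx; rewrite (cat_path _ _ (_ ++ _)) => /andP[-> _]; rewrite !catA last_cat /= hyc.
  rewrite cat_uniq; move: u; rewrite E cat_uniq => /and3P[_ _].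
  rewrite cat_uniq => /andP[-> _]; rewrite ur andbT /=.
  rewrite -[_ || _]/(has (mem (x :: a2 ++ m ++ Y1 ++ [:: y])) (c :: r)).
  apply/hasPn=> z /rC/dC; rewrite E => nz; apply: contra nz => zz.
  by rewrite mem_cat; apply/orP; right; rewrite mem_cat; apply/orP; left.
- by rewrite !size_cat /= !size_cat; lia.
Qed.

End Linking.

(** * Long cycles in dense graphs *)

(** Combines [dense_core], [reservoirs] and [path_cover]: the paths cover almost [d] vertices
    outside the reservoirs, and the giant components of the reservoirs link them. *)
Lemma dense_long_cycle (R : archiRealFieldType) (eps beta : R) :
    0 < eps < 1 -> 0 < beta <= 1 ->
  exists gam n0 : R, [/\ 0 < gam, 0 < n0 &
    forall (V : finType) (g h : rel V) (W : {set V}) (d : R),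
      symmetric g -> irreflexive g -> symmetric h ->
      n0 <= #|W|%:R -> beta * #|W|%:R <= d ->
      d * #|W|%:R <= ecount R g W W ->
      (forall X Y : {set V}, X \subset W -> Y \subset W ->
         gam * #|W|%:R ^+ 2 <= ecount R g X Y ->
         exists x y, [/\ x \in X, y \in Y & h x y]) ->
    exists s, [/\ (3 <= size s)%N, ucycle h s & (1 - eps) * d <= (size s)%:R]].
Proof.
move=> /andP[eps0 eps1] /andP[beta0 beta1].
(* One share of the loss for each of the dense core, the reservoirs, the uncovered vertices and the
   discarded path ends. *)
pose e1 := eps / 4; have e10 : 0 < e1 by rewrite divr_gt0.
have e14 : e1 < 1 / 4 by rewrite /e1; lra.
have ceilP (x : R) : 0 <= x -> x <= (Num.truncn x).+1%:R <= x + 1.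
  move=> x0; have /andP[le lt] := Num.Theory.truncn_itv x0.
  by rewrite ltW //= -natr1 lerD2r.
have [||hh [gam1 [n1 [hh0 gam10 cover]]]] := @path_cover R e1 (beta / 2).
- by rewrite e10; move: e14; clear; lra.
- by apply/andP; split; [rewrite divr_gt0|move: beta1 beta0; clear; lra].
(* Disjoint paths with at least [hh * N] vertices each number at most [T0]. *)
pose T0 := (Num.truncn hh^-1).+1.
have T0P : hh^-1 <= T0%:R by have /andP[] := ceilP hh^-1 (ltW (etrans (invr_gt0 hh) hh0)).
have T0R : (0 : R) < T0%:R by rewrite ltr0n.
have eb0 : 0 < e1 * beta by rewrite mulr_gt0.
(* A reservoir has at most [#|W| / q] vertices, so [T0] of them take up at most
   [e1 * beta * N / 2]. *)
pose q := (T0 * (Num.truncn (2 / (e1 * beta))).+1)%N.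
have q0 : (0 < q)%N by rewrite muln_gt0.
have qR : (0 : R) < q%:R by rewrite ltr0n.
have qP : 2 * T0%:R <= e1 * beta * q%:R.
  have /andP[le _] := ceilP (2 / (e1 * beta)) (ltW (divr_gt0 (ltr0Sn _ _) eb0)).
  move: le; rewrite ler_pdivrMr // /q natrM => /(ler_wpM2l (ltW T0R)); clear; lra.
have T0q : (T0 <= q)%N by rewrite leq_pmulr.
(* The path ends will have about [zeta * N] vertices: few enough that all of them together number at
   most [e1 * d], and at most a quarter of a path each, which leaves room for rounding up. *)
pose zeta := Order.min (e1 * beta / (4 * T0%:R)) (hh / 4).
have zeta0 : 0 < zeta by rewrite lt_min !divr_gt0 // mulr_gt0.
have zeta1 : 4 * T0%:R * zeta <= e1 * beta.
  by rewrite mulrC -ler_pdivlMr ?mulr_gt0 // ge_min lexx.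
have zeta2 : zeta <= hh / 4 by rewrite ge_min lexx orbT.
have zle1 : zeta <= 1.
  apply: le_trans (_ : 4 * T0%:R * zeta <= 1).
    have T1 : (1 : R) <= T0%:R by rewrite ler1n.
    by rewrite ler_peMl ?ltW //; move: T1; clear; lra.
  apply: le_trans zeta1 _; have := ler_pM (ltW e10) (ltW beta0) (_ : e1 <= 1) beta1.
  by rewrite mulr1; apply; move: e14; clear; lra.
pose mu := beta / 4; have mu0 : 0 < mu by rewrite divr_gt0.
pose cb : R := zeta * mu / (4 * q%:R).
have cb0 : 0 < cb by rewrite divr_gt0 // mulr_gt0.
(* A set of [zeta * N] vertices sends [cb * N ^+ 2] edges to a reservoir, of which the [eta * N]
   vertices outside the giant component absorb at most half. *)
pose eta : R := cb / 2; have eta0 : 0 < eta by rewrite divr_gt0.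
have etaP : 3 * eta * q%:R <= beta / 2.
  have -> : 3 * eta * q%:R = zeta * (3 * beta / 32) by rewrite /eta /cb /mu; field; rewrite gt_eqF.
  have : zeta * (3 * beta / 32) <= 1 * (3 * beta / 32).
    by rewrite ler_wpM2r // divr_ge0 // mulr_ge0 // ltW.
  by move: beta0; clear; lra.
pose kap : R := e1 * beta.
have [n2 res] := @reservoirs R kap mu zeta eta q eb0 mu0 zeta0 eta0 q0.
exists (Order.min gam1 (Order.min (cb / 2) (kap * eta ^+ 2 / 2))).
exists (Order.max 1 (Order.max n1 (Order.max n2 (Order.max (4 * T0%:R / (e1 * beta)) (4 / hh))))).
split.
- by rewrite !lt_min gam10 !divr_gt0 // mulr_gt0 // exprn_gt0.
- by rewrite lt_max ltr01.
move=> V g h W0 d gC gI hC.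
set N := #|W0|%:R; set gam := Order.min _ _.
rewrite !ge_max => /and5P[N1 n1N n2N n3N n4N] bNd dens hit.
have N0 : 0 < N by apply: lt_le_trans N1.
have d0 : 0 < d by apply: lt_le_trans bNd; rewrite mulr_gt0.
have hit' (c : R) (X Y : {set V}) : gam <= c -> X \subset W0 -> Y \subset W0 ->
  c * N ^+ 2 <= ecount R g X Y -> exists x y, [/\ x \in X, y \in Y & h x y].
  move=> gc sX sY le; apply: hit => //; apply: le_trans le.
  by rewrite ler_wpM2r ?sqr_ge0.
have gam_le1 : gam <= gam1 by rewrite ge_min lexx.
have gam_le2 : gam <= cb / 2 by rewrite !ge_min lexx orbT.
have gam_le3 : gam <= kap * eta ^+ 2 / 2 by rewrite !ge_min lexx !orbT.
pose D0 := (1 - e1) * d.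
have D00 : 0 < D0 by rewrite mulr_gt0 // subr_gt0; move: e14; clear; lra.
have W00 : W0 != set0 by rewrite -card_gt0 -(ltr_nat R).
have [||W [sW Wn0 fW degW cutW]] :=
  @dense_core R V g (fun=> D0) kap W0 gC gI _ (ltW eb0) W00.
- by [].
- rewrite sumr_const -(mulr_natr D0) -/N; apply: le_trans dens.
  have := ler_wpM2r (ltW N0) (ler_wpM2l (ltW e10) bNd).
  by rewrite /D0 /kap; clear; lra.
have WN : #|W|%:R <= N by rewrite ler_nat subset_leq_card.
have cW0 : (0 : R) < #|W|%:R by rewrite ltr0n card_gt0.
have DW : D0 <= #|W|%:R.
  rewrite -(ler_pM2r cW0); move: fW; rewrite sumr_const -(mulr_natr D0).
  have := ecount_le g W W : _ <= _ :> R.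
  have : 0 <= kap * #|W|%:R ^+ 2 by rewrite mulr_ge0 ?sqr_ge0 // ltW.
  by clear; lra.
have D0b : 3 / 4 * (beta * N) <= D0.
  have := ler_wpM2l (_ : 0 <= 1 - e1) bNd; rewrite -/D0.
  have : 0 <= (1 / 4 - e1) * (beta * N) by rewrite mulr_ge0 ?mulr_ge0 ?ltW // subr_gt0.
  move=> h1 h2; have {}h2 := h2 _; apply: le_trans (h2 _); last by move: e14; clear; lra.
  by move: h1; clear; lra.
have bN0 : 0 < beta * N by rewrite mulr_gt0.
have [|Rs [Rs1 Rs2 Rs3 Rs4]] := res V g W N gC n2N N0 Wn0 WN _ cutW.
  move=> v vW; apply: le_trans (degW v vW); rewrite /mu.
  by move: D0b bN0; clear; lra.
have compR i : (i < T0)%N -> exists C : {set V},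
    [/\ C \subset Rs i, #|Rs i :\: C|%:R < eta * N & connected_set h C].
  move=> iT; have iq := leq_trans iT T0q; have [sR _ cR] := Rs1 i iq.
  apply: (giant_component hC (mulr_gt0 eta0 N0)).
    rewrite -(ler_pM2l qR); apply: le_trans cR.
    have := ler_wpM2r (ltW N0) etaP; rewrite /mu.
    by move: DW D0b bN0; clear; lra.
  move=> A B dAB AB cA cB; apply: (hit' (kap * eta ^+ 2 / 2)) => //.
  - by apply: subset_trans sW; apply: subset_trans sR; rewrite -AB subsetUl.
  - by apply: subset_trans sW; apply: subset_trans sR; rewrite -AB subsetUr.
  - exact: (Rs4 i).
have [C CP] : exists C : nat -> {set V}, forall i, (i < T0)%N ->
    [/\ C i \subset Rs i, #|Rs i :\: C i|%:R < eta * N & connected_set h (C i)].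
  elim: (T0) compR => [|n IHn] compR; first by exists (fun=> set0).
  have [|C CP] := IHn; first by move=> i ilt; apply: compR; rewrite ltnW.
  have [Cn CnP] := compR n (ltnSn n).
  exists (fun i => if i == n then Cn else C i) => i; rewrite ltnS leq_eqVlt.
  by case: eqP => [->|_] //= /CP.
pose RR := \bigcup_(i < T0) Rs i.
pose W2 := W :\: RR.
have cRR : 2 * #|RR|%:R <= e1 * beta * N.
  have le : (q * #|RR| <= T0 * #|W|)%N.
    apply: (@leq_trans (\sum_(i < T0) q * #|Rs i|)%N).
      rewrite (_ : \sum_(i < T0) _ = q * \sum_(i < T0) #|Rs i|)%N; last by rewrite big_distrr.
      rewrite leq_mul2l; apply/orP; right; rewrite /RR.
      elim/big_ind2: _ => [|A a B b leA leB|i _]; rewrite ?cards0 //.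
      by rewrite cardsU leq_subLR (leq_trans (leq_add leA leB)) // leq_addl.
    rewrite -[T0 in leqRHS]card_ord -sum_nat_const; apply: leq_sum => i _.
    by have [_ + _] := Rs1 i (leq_trans (ltn_ord i) T0q).
  rewrite -(ler_pM2l qR).
  have le1 : q%:R * #|RR|%:R <= T0%:R * N.
    apply: (@le_trans _ _ (T0%:R * #|W|%:R)); first by rewrite -!natrM ler_nat.
    by rewrite ler_pM2l.
  by have := ler_wpM2r (ltW N0) qP; move: le1; clear; lra.
(* Removing the reservoirs lowers each degree by at most [e1 * beta * N / 2], so degrees in [W2] are
   at least [D / 2]. *)
pose D := D0 - e1 * beta * N.
have eN : e1 * beta * N <= e1 * d by rewrite -mulrA ler_pM2l.
have eN' : e1 * (beta * N) <= 1 / 4 * (beta * N) by rewrite ler_wpM2r // ltW.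
have cW2 : #|W|%:R <= #|W2|%:R + #|RR|%:R :> R.
  rewrite -natrD ler_nat -(cardsID RR W) addnC leq_add2l subset_leq_card //.
  exact: subsetIr.
have sW2 : W2 \subset W by apply: subsetDl.
have sW20 : W2 \subset W0 by apply: subset_trans sW.
have W2N : #|W2|%:R <= N by apply: le_trans WN; rewrite ler_nat subset_leq_card.
have [||||ps [ups psW hps sps szps]] := @cover V g h W2 N D gC gI hC n1N W2N.
- by rewrite /D; move: D0b eN' bN0; clear; lra.
- by rewrite /D; move: DW cW2 cRR (mulr_gt0 eb0 N0); clear; lra.
- move=> v vW2; have vW := subsetP sW2 v vW2.
  have : ecount R g [set v] W <= ecount R g [set v] W2 + ecount R g [set v] RR.
    apply: ecount_Ur_le; apply/subsetP=> x xW; rewrite !inE xW andbT.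
    by case: (x \in RR); rewrite ?orbT.
  have := ecount_le g [set v] RR : _ <= _ :> R; rewrite cards1 mul1r.
  by have := degW v vW; rewrite /D; move: cRR; clear; lra.
- move=> X Y sX sY; apply: (hit' gam1) => //; exact: subset_trans sW20.
have hhN : 4 <= hh * N by rewrite mulrC -ler_pdivrMr.
have hhN0 : 0 < hh * N by rewrite mulr_gt0.
have psT : (size ps <= T0)%N.
  rewrite -(ler_nat R); apply: le_trans T0P; rewrite -(ler_pM2r hhN0).
  rewrite [leRHS]mulrA mulVf ?gt_eqF // mul1r; apply: le_trans W2N.
  apply: (@le_trans _ _ (size (flatten ps))%:R).
    elim: (ps) sps => [_|p l IHl /= /andP[le /IHl le']]; first by rewrite mul0r.
    by rewrite size_cat natrD -natr1 mulrDl mul1r addrC lerD.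
  rewrite ler_nat -(card_uniqP ups) subset_leq_card //.
  by apply/subsetP=> x /psW.
pose l := (Num.truncn (zeta * N)).+1.
have /andP[l1 l2] : zeta * N <= l%:R <= zeta * N + 1 by rewrite ceilP // mulr_ge0 // ltW.
have ll p : p \in ps -> (l.*2 <= size p)%N.
  move=> /(allP sps) szp; rewrite -(ler_nat R) -muln2 natrM; apply: le_trans szp.
  by have := ler_wpM2r (ltW N0) zeta2; move: l2 hhN; clear; lra.
have lT : 2 * l%:R * T0%:R <= e1 * beta * N.
  have : 4 * T0%:R <= e1 * beta * N by move: n3N; rewrite ler_pdivrMr //; clear; lra.
  have := ler_wpM2r (ltW N0) zeta1; have := ler_wpM2l (ltW T0R) l2.
  by clear; lra.
have att j (Z : seq V) : (j < T0)%N -> uniq Z -> {subset Z <= W2} -> size Z = l ->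
    exists z c, [/\ z \in Z, c \in C j & h z c].
  move=> jT uZ ZW sZ; have [sC cC _] := CP j jT; have jq := leq_trans jT T0q.
  have [sR _ _] := Rs1 j jq.
  pose X := [set x in Z].
  have cX : #|X| = l by rewrite cardsE (card_uniqP uZ).
  have sX : X \subset W by apply/subsetP=> x; rewrite inE => /ZW/(subsetP sW2).
  have := Rs3 j X jq sX; rewrite cX => /(_ l1) eX.
  have [||z [c [zX cC' hzc]]] := hit' (cb / 2) X (C j) gam_le2 (subset_trans sX sW).
  - by apply: subset_trans sC _; apply: subset_trans sR sW.
  - have : ecount R g X (Rs j) <= ecount R g X (C j) + ecount R g X (Rs j :\: C j).
      apply: ecount_Ur_le; apply/subsetP=> x xR; rewrite !inE xR andbT.
      by case: (x \in C j).
    have := ecount_le g X (Rs j :\: C j) : _ <= _ :> R.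
    have lN : #|X|%:R <= N by apply: le_trans WN; rewrite ler_nat subset_leq_card.
    have : #|X|%:R * #|Rs j :\: C j|%:R <= N * (eta * N).
      by apply: ler_pM => //; apply: ltW.
    by move: eX; rewrite -/cb /eta; clear; lra.
  by exists z, c; split=> //; rewrite inE in zX.
have D0' : (1 - 2 * e1) * d <= D by rewrite /D /D0; move: eN; clear; lra.
case: ps ups psW hps sps szps psT ll => [|p ps] ups psW hps sps szps psT ll.
  have : 0 < (1 - e1) * D.
    apply: mulr_gt0; first by move: e14; clear; lra.
    by apply: lt_le_trans D0'; apply: mulr_gt0 => //; move: e14; clear; lra.
  by move: szps => /= le /lt_le_trans/(_ le); rewrite ltxx.
have [X [M [Y [pE sX sY sM]]]] := split_ends (ll p (mem_head _ _)).
have dis x j : x \in W2 -> (j < T0)%N -> x \notin C j.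
  move=> xW2 jT; apply/negP=> xC; have [sC _ _] := CP j jT.
  move: xW2; rewrite inE => /andP[/negP nx _]; apply: nx; apply/bigcupP.
  by exists (Ordinal jT) => //; apply: (subsetP sC).
move: (ups); rewrite /= cat_uniq => /and3P[up nps ups'].
have pW : {subset p <= W2} by move=> x xp; apply: psW; rewrite /= mem_cat xp.
move: (hps) => /= /andP[hp hps'].
have XpW : {subset X <= W2} by move=> x xX; apply: pW; rewrite pE mem_cat xX.
have [||||||||||||||m' [Y' [u' h' [Y'W sY'] dz' le]]] := @link_chain V h hC C T0 l W2
  _ _ _ att ps 0%N X M Y; rewrite ?add0n -?pE //.
- by move=> j /CP[].
- move=> i j iT jT nij; have [sCi _ _] := CP i iT; have [sCj _ _] := CP j jT.
  by apply: disjointWl sCi (disjointWr sCj (Rs2 i j _ _ nij)); apply: leq_trans T0q.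
- move=> j jT; rewrite disjoints_subset; apply/subsetP=> x xW2; rewrite inE; exact: dis.
- exact: ltnW.
- by move=> x xY; apply: pW; rewrite pE !mem_cat xY !orbT.
- by move=> x j /pW xW2 /andP[_]; apply: dis.
- by move=> x xps; apply: psW; rewrite /= mem_cat xps orbT.
- by move=> x xp; apply/negP=> xps; move/hasPn: nps => /(_ x xps); rewrite /= xp.
- by apply/allP=> p' p'ps; apply: ll; rewrite inE p'ps orbT.
(* The [size ps] links used the components with smaller indices; the one with index [size ps < T0]
   is still free and closes the cycle. *)
have [_ _ conC] := CP (size ps) psT.
have [|||s [s3 us les]] := close_chain hC conC u' h'.
- move=> z zC; apply/negP => zz; have := dz' z (size ps) zz.
  by rewrite add0n leqnn psT zC => /(_ isT).
- by apply: att => //; move: u'; rewrite catA cat_uniq => /and3P[].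
- by apply: att => //; move: u'; rewrite cat_uniq => /andP[].
exists s; split=> //.
have szE : (size (flatten (p :: ps)) <= size s + T0 * l.*2)%N.
  apply: (@leq_trans (\sum_(p' <- p :: ps) (size p' - l.*2) + size (p :: ps) * l.*2)%N).
    elim: (p :: ps) ll => //= p' ps2 IH ll; rewrite big_cons size_cat mulSn addnACA.
    rewrite leq_add ?IH ?subnK ?ll ?mem_head // => p2 p2ps; apply: ll.
    by rewrite inE p2ps orbT.
  rewrite leq_add ?leq_mul2r ?psT ?orbT // big_cons -sM.
  by rewrite (leq_trans le).
move: szE; rewrite -(ler_nat R) natrD natrM -muln2 natrM => szE.
have : (1 - e1) * ((1 - 2 * e1) * d) <= (1 - e1) * D.
  by rewrite ler_wpM2l // subr_ge0 ltW // (lt_trans e14) //; clear; lra.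
have : 0 <= e1 * e1 * d by apply: mulr_ge0; [apply: mulr_ge0|]; apply: ltW.
have -> : (1 - eps) * d = (1 - 4 * e1) * d by rewrite /e1; field.
by move: szps szE lT eN; clear; lra.
Qed.

(** * Normal forests and their decomposition into pieces *)

Section Forests.
Local Open Scope nat_scope.
Variable V : finType.
Implicit Types (par : V -> V) (r : V -> nat) (h : rel V).

(* The roots are the fixed points of par; a rank certifies that par has no other
   cycle. *)
Definition is_rank par r :=
  [forall v, if par v == v then r v == 0 else r v == (r (par v)).+1].

Definition ancestor par : rel V := fun u v => fconnect par v u.

Lemma rank_iter par r v k : is_rank par r -> k <= r v -> r (iter k par v) = r v - k.
Proof.
move=> /forallP rk; elim: k => [|k IHk] kr /=; first by rewrite subn0.
have := rk (iter k par v); rewrite IHk ?(ltnW kr) //.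
case: eqP => [_|_] /eqP; move: (r v) kr (r (par _)) => n kr n'; lia.
Qed.

Lemma rank0_root par r v : is_rank par r -> r v = 0 -> par v = v.
Proof. by move=> /forallP/(_ v) rk rv0; move: rk; case: eqP => // _; rewrite rv0. Qed.

Lemma root_rank0 par r v : is_rank par r -> par v = v -> r v = 0.
Proof. by move=> /forallP/(_ v) + Ev; rewrite Ev eqxx => /eqP. Qed.

(** After [r v] steps the iteration stays at a root, so at most [r v] steps are needed to reach [u],
    and each of them lowers the rank by one. *)
Lemma ancestorE par r u v : is_rank par r -> ancestor par u v ->
  r u <= r v /\ u = iter (r v - r u) par v.
Proof.
move=> rk /iter_findex <-; set k := findex _ _ _.
have [kr|rk'] := leqP k (r v).
  by rewrite (rank_iter rk kr) leq_subr subKn.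
have E : iter k par v = iter (r v) par v.
  rewrite -(subnK (ltnW rk')) iterD.
  have : par (iter (r v) par v) = iter (r v) par v.
    by apply: (rank0_root rk); rewrite (rank_iter rk) // subnn.
  by elim: (k - r v) => //= n IHn E; rewrite IHn.
by rewrite E (rank_iter rk (leqnn _)) subnn subn0.
Qed.

Lemma ancestor_refl par : reflexive (ancestor par).
Proof. by move=> v; apply: connect0. Qed.

Lemma ancestor_trans par : transitive (ancestor par).
Proof. by move=> y x z; rewrite /ancestor => yx zy; apply: connect_trans zy yx. Qed.

Lemma ancestor_anti par r u v : is_rank par r ->
  ancestor par u v -> ancestor par v u -> u = v.
Proof.
move=> rk uv vu; have [le1 E] := ancestorE rk uv; have [le2 _] := ancestorE rk vu.
by rewrite E (eqP (_ : r v - r u == 0)) // subn_eq0.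
Qed.

Lemma ancestor_chain par u1 u2 v : ancestor par u1 v -> ancestor par u2 v ->
  ancestor par u1 u2 || ancestor par u2 u1.
Proof.
move=> /iter_findex <- /iter_findex <-.
set i := findex _ _ _; set j := findex _ _ _; apply/orP.
have [ij|/ltnW ji] := leqP i j; [right|left]; rewrite /ancestor.
  by rewrite -(subnK ij) iterD fconnect_iter.
by rewrite -(subnK ji) iterD fconnect_iter.
Qed.

(** The iterates from [v] up to its root have distinct ranks. The bound confines ranks to a finite
    type when a forest of maximal depth is chosen. *)
Lemma rank_lt_card par r v : is_rank par r -> r v < #|V|.
Proof.
move=> rk; pose f (k : 'I_(r v).+1) := iter k par v.
have finj : injective f.
  move=> i j fij; apply/val_inj.
  have li : i <= r v by rewrite -ltnS.
  have lj : j <= r v by rewrite -ltnS.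
  have := congr1 r fij; rewrite /f !(rank_iter rk) //; move: li lj => /=.
  by move: (r v) (val i) (val j) => n a b; lia.
by have := leq_card f finj; rewrite card_ord.
Qed.

(** The cycle climbs from [v] to its ancestor [u] along the forest and returns by the edge [u v]; a
    rank difference above 1 ensures three vertices. *)
Lemma long_edge_cycle h par r u v : symmetric h -> is_rank par r ->
  (forall w, par w = w \/ h w (par w)) -> ancestor par u v -> h u v ->
  1 < r v - r u -> exists s, [/\ 3 <= size s, ucycle h s & size s = (r v - r u).+1].
Proof.
move=> hC rk hpar anc huv lt; have [le E] := ancestorE rk anc.
exists (traject par v (r v - r u).+1); split; rewrite ?size_traject //.
have root w : 0 < r w -> h w (par w).
  by move=> rw; case: (hpar w) => // /(root_rank0 rk) r0; rewrite r0 in rw.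
apply/andP; split.
  rewrite /= rcons_path; apply/andP; split; last first.
    by rewrite last_traject -E.
  suff pth n w : n <= r w -> path h w (traject par (par w) n).
    by apply: pth; apply: leq_subr.
  elim: n w => // n IHn w nr /=.
  have rw : 0 < r w by apply: leq_trans nr.
  rewrite root // IHn //.
  have := rank_iter rk (k := 1) rw; rewrite /= => ->.
  by move: (r w) nr => m; lia.
have rks k w : k < r w + 2 -> uniq (traject par w k).
  elim: k w => //= k IHk w kr; rewrite -/(traject par (par w) k).
  case: k IHk kr => // k IHk kr.
  have rw : 0 < r w by move: (r w) kr => m; lia.
  have rpw := rank_iter rk (k := 1) rw; rewrite /= in rpw.
  rewrite IHk ?andbT; last by rewrite rpw; move: (r w) kr rw => m; lia.
  apply/trajectP=> -[i lt_i Ei].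
  have := congr1 r Ei; rewrite (rank_iter rk) rpw.
    by move: (r w) rw => m; lia.
  by move: (r w) rw kr lt_i => m; lia.
by apply: rks; move: (r v) (r u) => a b; lia.
Qed.

(* Maximise the sum of the ranks: if an edge u v joins incomparable vertices with
   r v <= r u, hanging the subtree of v below u increases it. *)
Lemma normal_forest h : symmetric h -> irreflexive h ->
  exists (par : {ffun V -> V}) (r : V -> nat), [/\ is_rank par r,
    forall v, par v = v \/ h v (par v) &
    forall u v, h u v -> ancestor par u v || ancestor par v u].
Proof.
move=> hC hI.
pose T := ({ffun V -> V} * {ffun V -> 'I_#|V|.+1})%type.
pose ok (x : T) := is_rank x.1 (fun v => x.2 v) && [forall v, (x.1 v == v) || h v (x.1 v)].
pose x0 : T := ([ffun v => v], [ffun => ord0]).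
have ok0 : ok x0.
  rewrite /ok; apply/andP; split; last by apply/forallP=> v; rewrite ffunE eqxx.
  by apply/forallP=> v; rewrite !ffunE eqxx.
pose score (x : T) := \sum_v (x.2 v : nat).
have [[par rf] /andP[rk /forallP hpar] maxs] := @arg_maxnP T x0 ok score ok0.
pose r v : nat := rf v; rewrite /= in rk hpar maxs.
exists par, r; split=> //.
  by move=> v; have /orP[/eqP|] := hpar v; [left|right].
suff key u v : h u v -> r v <= r u -> ancestor par u v || ancestor par v u.
  move=> u v huv; have [le|/ltnW le] := leqP (r v) (r u); first exact: key.
  by rewrite orbC; apply: key; rewrite // hC.
move=> huv le; apply: contraT; rewrite negb_or => /andP[nuv nvu].
(* The shift that puts [v] just below [u], applied to the whole subtree of [v]; it is positive
   because [r v <= r u]. *)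
pose k := (r u).+1 - r v.
pose par' := [ffun w => if w == v then u else par w].
pose r' w := if ancestor par v w then r w + k else r w.
have nvu' : u != v by apply: contraTneq huv => ->; rewrite hI.
have ancp w : w != v -> ancestor par v (par w) = ancestor par v w.
  move=> wv; apply/idP/idP; last first.
    rewrite /ancestor => /iter_findex; case: (findex _ _ _) => [|n] /= E.
      by rewrite E eqxx in wv.
    by rewrite -E -iterS iterSr fconnect_iter.
  by apply: connect_trans; apply: fconnect1.
have rk' : is_rank par' r'.
  apply/forallP=> w; rewrite !ffunE; have [->|wv] := eqVneq w v.
    rewrite (negPf nvu') /r' (negPf nvu) ancestor_refl /k subnKC //.
    exact: leq_trans le (leqnSn _).
  rewrite /r' ancp //; have := forallP rk w; rewrite -/(r _) -/(r _).
  case: eqP => [Ew|_] /eqP Er.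
    case: ifP => anc; last by rewrite Er.
    have [lev Ev] := ancestorE rk anc.
    move: Ev; rewrite -/(r w) Er sub0n /= => Ev.
    by rewrite Ev eqxx in wv.
  by case: ifP => _; rewrite Er // addSn.
pose x' : T := (par', [ffun w => inord (r' w)]).
have r'E w : (x'.2 w : nat) = r' w.
  by rewrite /= ffunE inordK // ltnS ltnW // (rank_lt_card _ rk').
have ok' : ok x'.
  apply/andP; split.
    apply/forallP=> w; rewrite !r'E; exact: (forallP rk').
  apply/forallP=> w; rewrite /= !ffunE; have [->|_] := eqVneq w v; last exact: hpar.
  by rewrite hC huv orbT.
have := maxs x' ok'; rewrite leqNgt => /negP; case.
rewrite /score (bigD1 v) //= [X in _ < X](bigD1 v) //= -addSn; apply: leq_add.
  rewrite r'E /r' ancestor_refl -/(r v) -[X in X < _]addn0 ltn_add2l /k subn_gt0 ltnS //.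
apply: leq_sum => w _; rewrite r'E /r' -/(r w); case: ifP => // _; exact: leq_addr.
Qed.

End Forests.

(** * Cutting a forest order into pieces of bounded size *)

Section Pieces.
Local Open Scope nat_scope.
Variables (V : finType) (le : rel V).
Hypothesis (le_refl : reflexive le) (le_trans : transitive le).
Hypothesis le_anti : forall u v, le u v -> le v u -> u = v.
Hypothesis le_chain : forall u1 u2 v, le u1 v -> le u2 v -> le u1 u2 || le u2 u1.
Implicit Types (D Q B : {set V}).

Definition up_closed D := forall u v, v \in D -> le u v -> u \in D.

(** The ancestors of [Q] outside [Q] all belong to the chain above one vertex [x], hence are few
    once the distance is bounded. The value [None] stands for a piece that contains all its
    ancestors. *)
Definition hangs Q (o : option V) := forall u v, v \in Q -> le u v ->
  u \in Q \/ exists x, [/\ o = Some x, le u x & le x v].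

(** Below a minimal vertex [x] whose subtree has more than [m] elements, all subtrees have at most
    [m]. A minimal union of these with at least [m] elements has at most [2 m], and hangs at [x]. If
    no subtree is that large, all of [D] takes the place of the set below [x]. *)
Lemma piece_step D m : up_closed D -> 0 < m <= #|D| ->
  exists Q o, [/\ Q \subset D, m <= #|Q| <= m.*2, up_closed (D :\: Q) & hangs Q o].
Proof.
move=> upD /andP[m0 mD].
pose T x := [set w in D | le x w].
have [B [o [sBD mB small downB hangB]]] : exists B (o : option V),
  [/\ B \subset D, m <= #|B|, {in B, forall y, #|T y| <= m},
      forall y w, y \in B -> w \in D -> le y w -> w \in B & hangs B o].
  have [/exists_inP[x0 x0D mx0]|] := boolP [exists x in D, m < #|T x|]; last first.
    rewrite negb_exists_in => /forall_inP nbig; exists D, None; split=> //.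
      by move=> y yD; rewrite leqNgt nbig.
    by move=> u v vD /(upD u v vD); left.
  pose P x := (x \in D) && (m < #|T x|).
  have [|x /andP[xD mx] minx] := @arg_minnP V x0 P (fun x => #|T x|).
    by rewrite /P x0D.
  exists (T x :\ x), (Some x); split.
  - by apply/subsetP=> w; rewrite !inE => /and3P[].
  - by move: mx; rewrite (cardsD1 x) inE xD le_refl.
  - move=> y; rewrite !inE => /and3P[yx yD xy]; rewrite leqNgt; apply/negP=> my.
    have := minx y; rewrite /P yD my => /(_ isT); rewrite leqNgt => /negP; apply.
    apply: proper_card; apply/properP; split.
      by apply/subsetP=> w; rewrite !inE => /andP[-> yw]; apply: le_trans yw.
    exists x; rewrite !inE xD ?le_refl //; apply: contra yx => yx.
    by apply/eqP; apply: le_anti.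
  - move=> y w; rewrite !inE => /and3P[yx yD xy] wD yw; rewrite wD (le_trans xy yw) !andbT.
    by apply: contra yx => /eqP wx; apply/eqP; apply: le_anti => //; rewrite -wx.
  - move=> u v; rewrite !inE => /and3P[vx vD xv] uv.
    have /orP[ux|xu] := le_chain uv xv; first by right; exists x.
    have [->|ux] := eqVneq u x; first by right; exists x.
    by left; rewrite xu (upD u v).
pose cl Q := [forall v in Q, forall u in B, (le u v || le v u) ==> (u \in Q)].
have clP Q v u : cl Q -> v \in Q -> u \in B -> le u v || le v u -> u \in Q.
  by move=> /forall_inP clQ vQ uB c; have /forall_inP/(_ u uB) := clQ v vQ; rewrite c.
pose P Q := [&& Q \subset B, m <= #|Q| & cl Q].
have PB : P B.
  rewrite /P subxx mB; apply/forall_inP=> v vB; apply/forall_inP=> u uB.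
  by rewrite uB implybT.
have [Q /minsetP[/and3P[sQB mQ clQ] minQ] _] := @minset_exists V P B PB.
have /card_gt0P[y0 y0Q] : 0 < #|Q| by apply: leq_trans mQ.
(* A topmost element [y] of [Q]: its subtree is a whole component of [Q], so removing it leaves a
   set closed under comparability. *)
have [y yQ miny] := @arg_minnP V y0 (mem Q) (fun y => #|[set z in Q | le z y]|) y0Q.
have {}yQ : y \in Q by [].
have top z : z \in Q -> le z y -> z = y.
  move=> zQ zy; apply/eqP; apply: contraT => nzy.
  have := miny z zQ; rewrite leqNgt => /negP; case.
  apply: proper_card; apply/properP; split.
    by apply/subsetP=> w; rewrite !inE => /andP[-> wz]; apply: le_trans wz zy.
  exists y; rewrite !inE ?yQ ?le_refl // ; apply: contra nzy => yz.
  by apply/eqP; apply: le_anti.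
have yB := subsetP sQB y yQ.
exists Q, o; split.
- exact: subset_trans sQB sBD.
(* The subtree of [y] has at most [m] elements, and by minimality of [Q] so has the remainder. *)
- rewrite mQ -addnn -(cardsID (T y) Q) leq_add //.
    apply: leq_trans (small y yB); exact: subset_leq_card (subsetIr _ _).
  rewrite leqNgt; apply/negP=> big.
  have := minQ (Q :\: T y); rewrite /P (subset_trans (subsetDl _ _) sQB) (ltnW big).
  have -> : cl (Q :\: T y).
    apply/forall_inP=> v; rewrite !inE negb_and => /andP[nTv vQ]; apply/forall_inP=> u uB.
    have uD := subsetP sBD u uB; have vD := subsetP sBD v (subsetP sQB v vQ).
    rewrite vD /= in nTv.
    apply/implyP=> c; have uQ := clP Q v u clQ vQ uB c.
    rewrite !inE uQ uD /= andbT; apply: contra nTv => yu.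
    case/orP: c => [uv|vu]; first exact: le_trans uv.
    have /orP[//|vy] := le_chain yu vu.
    by rewrite (top v).
  move=> /(_ isT (subsetDl _ _)) E; move: yQ; rewrite -E !inE le_refl.
  by rewrite (subsetP sBD y yB).
- move=> u v; rewrite !inE => /andP[nvQ vD] uv; rewrite (upD u v) // andbT.
  apply: contra nvQ => uQ; apply: (clP Q u v clQ uQ _ _); last by rewrite uv orbT.
  exact: downB (subsetP sQB u uQ) vD uv.
- move=> u v vQ uv; have [uB|//] := hangB u v (subsetP sQB v vQ) uv; last by right.
  by left; apply: (clP Q v u clQ vQ uB); rewrite uv.
Qed.

Lemma piece_decomposition m : 0 < m ->
  exists qs : seq ({set V} * option V),
    [/\ pairwise (fun a b : {set V} * option V => [disjoint a.1 & b.1]) qs,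
        all (fun a : {set V} * option V => m <= #|a.1| <= m.*2) qs,
        {in qs, forall a, hangs a.1 a.2} &
        #|~: \bigcup_(a <- qs) a.1| < m].
Proof.
move=> m0.
suff : forall n D, #|D| < n -> up_closed D -> exists qs : seq ({set V} * option V),
    [/\ pairwise (fun a b : {set V} * option V => [disjoint a.1 & b.1]) qs,
        all (fun a : {set V} * option V => (a.1 \subset D) && (m <= #|a.1| <= m.*2)) qs,
        {in qs, forall a, hangs a.1 a.2} &
        #|D :\: \bigcup_(a <- qs) a.1| < m].
  move=> /(_ #|V|.+1 setT); rewrite cardsT ltnSn => /(_ isT)[|qs [pw sz hg lt]].
    by move=> u v; rewrite !inE.
  exists qs; split=> //; last by rewrite -setTD.
  by apply/allP=> a /(allP sz)/andP[].
elim=> // n IHn D; rewrite ltnS => Dn upD.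
have [Dm|mD] := ltnP #|D| m.
  by exists [::]; split=> //; rewrite big_nil setD0.
have [|Q [o [sQ mQ upDQ hg]]] := @piece_step D m upD; first by rewrite m0.
have [|qs [pw sz hgs lt]] := IHn (D :\: Q) _ upDQ.
  apply: leq_trans Dn; rewrite -(cardsID Q D) (setIidPr sQ) -[X in X < _]add0n ltn_add2r.
  by case/andP: mQ => mQ _; apply: leq_trans mQ.
exists ((Q, o) :: qs); split=> /=.
- rewrite pw andbT; apply/allP=> a /(allP sz)/andP[sa _] /=.
  by rewrite disjoint_sym disjoints_subset (subset_trans sa) // subsetDr.
- rewrite sQ mQ; apply/allP=> a /(allP sz)/andP[sa ->]; rewrite andbT.
  exact: subset_trans sa (subsetDl _ _).
- by move=> a; rewrite inE => /predU1P[->|/hgs].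
- by rewrite big_cons -setDDl.
Qed.

End Pieces.

(** * Encoding vertex sets; edges along a forest *)

Section Coding.
Variable V : finType.
Implicit Types (P Q A B X Y : {set V}) (q : {set V} * {set V}).

(** Matches the enumerations of [P] and [Q] position by position; the map is determined by the two
    sets, so a code need not record it. *)
Definition embed Q P (u : V) : V := nth u (enum Q) (index u (enum P)).

Lemma embed_in Q P u : (#|P| <= #|Q|)%N -> u \in P -> embed Q P u \in Q.
Proof.
move=> PQ uP; rewrite -(mem_enum (mem Q)) mem_nth // -cardE.
by apply: leq_trans PQ; rewrite cardE index_mem mem_enum.
Qed.

Lemma embed_inj Q P : (#|P| <= #|Q|)%N -> {in P &, injective (embed Q P)}.
Proof.
move=> PQ u v uP vP; have lt x : x \in P -> (index x (enum P) < size (enum Q))%N.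
  by move=> xP; rewrite -cardE; apply: leq_trans PQ; rewrite cardE index_mem mem_enum.
rewrite /embed (set_nth_default v) ?lt // => /eqP.
rewrite nth_uniq ?lt ?enum_uniq // => /eqP E.
by apply: (index_inj u _ _ E); rewrite mem_enum.
Qed.

(* A global pair of sets encodes one subset of Q :|: P for every block (Q, P):
   the blocks have disjoint first components, and P is copied into Q. *)
Definition decode (q : {set V} * {set V}) A B : {set V} :=
  (A :&: q.1) :|: [set u in q.2 | embed q.1 q.2 u \in B].

Definition set_code := ({set V} * {set V} * {set V} * {set V})%type.

Definition decode1 q (w : set_code) := decode q w.1.1.1 w.1.1.2.
Definition decode2 q (w : set_code) := decode q w.1.2 w.2.

Lemma decodeK q X : (#|q.2| <= #|q.1|)%N -> [disjoint q.1 & q.2] -> X \subset q.1 :|: q.2 ->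
  decode q (X :&: q.1) [set embed q.1 q.2 u | u in X :&: q.2] = X.
Proof.
move=> PQ dis sX; apply/setP=> x; rewrite !inE.
have := subsetP sX x; rewrite !inE => xX.
case x1: (x \in q.1).
  rewrite (disjointFr dis x1) /= orbF !andbT //.
case x2: (x \in q.2) => /=; last first.
  by rewrite !andbF /=; apply/esym/negbTE/negP=> /xX; rewrite x1 x2.
rewrite andbF /=; apply/imsetP/idP => [[y]|xX'].
  rewrite inE => /andP[yX y2] E; rewrite (embed_inj PQ x2 y2 E) //.
by exists x; rewrite // inE xX' x2.
Qed.

(** Decoding reads the global sets only inside [q.1], so blocks with disjoint first components do
    not interfere. *)
Lemma decode_local q A B A' B' : (#|q.2| <= #|q.1|)%N ->
  A :&: q.1 = A' :&: q.1 -> B :&: q.1 = B' :&: q.1 -> decode q A B = decode q A' B'.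
Proof.
move=> PQ EA EB; rewrite /decode EA; congr (_ :|: _); apply/setP=> x; rewrite !inE.
case x2: (x \in q.2) => //=; have e1 := embed_in PQ x2.
by have /setP/(_ (embed q.1 q.2 x)) := EB; rewrite !inE e1 !andbT.
Qed.

(** Overwrite the global sets on [q.1] block by block. Four global sets suffice for any number of
    blocks, which keeps the number of codes at [16 ^ #|V|]. *)
Lemma encode (qs : seq ({set V} * {set V})) (pr : {set V} * {set V} -> {set V} -> {set V} -> Prop) :
  pairwise (fun a b : {set V} * {set V} => [disjoint a.1 & b.1]) qs ->
  {in qs, forall q, (#|q.2| <= #|q.1|)%N /\ [disjoint q.1 & q.2]} ->
  {in qs, forall q, exists X Y : {set V}, [/\ X \subset q.1 :|: q.2, Y \subset q.1 :|: q.2 & pr q X Y]} ->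
  exists w : set_code, {in qs, forall q, pr q (decode1 q w) (decode2 q w)}.
Proof.
elim: qs => [_ _ _|q qs IHqs /= /andP[dq pw] sz ex]; first by exists (set0, set0, set0, set0).
have [[[[A B] A'] B'] wP] : exists w : set_code, {in qs, forall q, pr q (decode1 q w) (decode2 q w)}.
  by apply: IHqs => // q' q'qs; [apply: sz|apply: ex]; rewrite inE q'qs orbT.
have [X [Y [sX sY prXY]]] := ex q (mem_head _ _).
have [PQ dis] := sz q (mem_head _ _).
pose glue (C Z : {set V}) := C :\: q.1 :|: Z :&: q.1.
pose im (Z : {set V}) := [set embed q.1 q.2 u | u in Z :&: q.2].
exists (glue A (X :&: q.1), glue B (im X), glue A' (Y :&: q.1), glue B' (im Y)).
have glueq (C Z : {set V}) : glue C Z :&: q.1 = Z :&: q.1.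
  by apply/setP=> x; rewrite !inE; case: (x \in q.1); rewrite ?andbF ?andbT //= orbF.
have glueq' (q' : {set V} * {set V}) (C Z : {set V}) : q' \in qs -> glue C Z :&: q'.1 = C :&: q'.1.
  move=> /(allP dq) /= dqq'; apply/setP=> x; rewrite !inE.
  case x1: (x \in q'.1); last by rewrite !andbF.
  by rewrite (disjointFl dqq' x1) /= andbF orbF !andbT.
move=> q'; rewrite inE => /predU1P[->|q'qs].
  rewrite /decode1 /decode2 /=.
  rewrite (decode_local (A' := X :&: q.1) (B' := im X) PQ) ?glueq //.
  rewrite (decode_local (A := glue A' _) (A' := Y :&: q.1) (B' := im Y) PQ) ?glueq //.
  by rewrite !decodeK.
have [PQ' _] : (#|q'.2| <= #|q'.1|)%N /\ [disjoint q'.1 & q'.2] by apply: sz; rewrite inE q'qs orbT.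
rewrite /decode1 /decode2 /=.
rewrite (decode_local (A' := A) (B' := B) PQ') ?glueq' //.
rewrite (decode_local (A := glue A' _) (A' := A') (B' := B') PQ') ?glueq' //.
exact: wP.
Qed.

End Coding.

(** * Short vertical edges and their distribution among the pieces *)

Section ShortEdges.
Variables (V : finType) (G : rel V) (par : V -> V) (r : V -> nat) (L : nat).
Implicit Types (a : {set V} * option V).
Hypotheses (GC : symmetric G) (GI : irreflexive G) (rk : is_rank par r).

Definition short_up u v := [&& G u v, ancestor par u v & (r v - r u < L)%N].
Definition nonvertical u v := [&& G u v, ~~ ancestor par u v & ~~ ancestor par v u].
Definition long u v :=
  G u v && (ancestor par u v && (L <= r v - r u)%N || ancestor par v u && (L <= r u - r v)%N).
(** A short vertical edge is assigned to the piece containing its lower end, so disjoint pieces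
    receive disjoint sets of edges. *)
Definition piece_rel (Q : {set V}) u v := (v \in Q) && short_up u v || (u \in Q) && short_up v u.
Definition up v := #|[set u | short_up u v]|.

Lemma piece_relC Q : symmetric (piece_rel Q).
Proof. by move=> u v; rewrite /piece_rel orbC. Qed.

Lemma piece_relI Q : irreflexive (piece_rel Q).
Proof. by move=> u; rewrite /piece_rel /short_up GI !andbF. Qed.

Lemma piece_rel_sub Q : subrel (piece_rel Q) G.
Proof. by move=> u v /orP[]/andP[_ /and3P[]] //; rewrite GC. Qed.

Lemma nonverticalC : symmetric nonvertical.
Proof. by move=> u v; rewrite /nonvertical GC [X in _ && X]andbC. Qed.

Lemma longC : symmetric long.
Proof. by move=> u v; rewrite /long GC orbC. Qed.

Lemma edge_cases u v :
  (G u v <= nonvertical u v + long u v + (short_up u v + short_up v u))%N.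
Proof.
rewrite /nonvertical /long /short_up (GC v u); case: (G u v) => //=.
case: (ancestor par u v); case: (ancestor par v u) => //=; rewrite ?(ltnNge _ L);
by case: (L <= _)%N; case: (L <= _)%N.
Qed.

Lemma near_ancestors_card v : (#|[set u | ancestor par u v & r v - r u < L]| <= L)%N.
Proof.
rewrite -[X in (_ <= X)%N]card_ord.
apply: leq_trans (leq_imset_card (fun k : 'I_L => iter k par v) _).
apply: subset_leq_card; apply/subsetP=> u; rewrite inE => /andP[uv lt].
by apply/imsetP; exists (Ordinal lt) => //=; case: (ancestorE rk uv).
Qed.

Lemma up_le v : (up v <= L)%N.
Proof.
apply: leq_trans (near_ancestors_card v); apply: subset_leq_card.
by apply/subsetP=> u; rewrite !inE => /and3P[_ -> ->].
Qed.

Definition near_part (a : {set V} * option V) : {set V} :=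
  if a.2 is Some x then [set u | ancestor par u x & r x - r u < L]%N :\: a.1 else set0.

Lemma near_part_card a : (#|near_part a| <= L)%N.
Proof.
case: a => Q [x|]; rewrite /near_part /= ?cards0 //.
by apply: leq_trans (near_ancestors_card x); rewrite subset_leq_card ?subsetDl.
Qed.

Lemma near_part_disjoint a : [disjoint a.1 & near_part a].
Proof.
case: a => Q [x|]; rewrite /near_part /=; last by rewrite disjoints_subset setC0 subsetT.
by rewrite disjoint_sym disjoints_subset subsetDr.
Qed.

(** If the upper end [u] lies outside the piece, the vertex [x] where the piece hangs lies between
    [u] and [v], so [u] is within distance [L] of [x] as well. *)
Lemma near_part_short a u v : hangs (ancestor par) a.1 a.2 -> v \in a.1 ->
  short_up u v -> u \in a.1 :|: near_part a.
Proof.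
case: a => Q o /= hg vQ /and3P[_ uv lt].
case: (hg u v vQ uv) => [|[x [-> ux xv]]]; first by rewrite inE => ->.
rewrite /near_part /= !inE ux; case: (u \in Q) => //=.
have [ruv _] := ancestorE rk ux; have [rxv _] := ancestorE rk xv.
by move: (r u) (r v) (r x) lt ruv rxv => *; lia.
Qed.

(** Each short edge has exactly one lower end, by antisymmetry, and is counted as two ordered
    pairs. *)
Lemma ecount_piece (R : realFieldType) (Q N : {set V}) :
    (forall u v, v \in Q -> short_up u v -> u \in N) -> Q \subset N ->
  ecount R (piece_rel Q) N N = 2 * (\sum_(v in Q) up v)%:R.
Proof.
move=> hN sQN.
pose A := \sum_(u in N) \sum_(v in N) ((v \in Q) && short_up u v)%:R : R.
have -> : ecount R (piece_rel Q) N N = A + A.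
  rewrite {2}/A exchange_big /= -big_split /=; apply: eq_bigr => u _.
  rewrite -big_split /=; apply: eq_bigr => v _; rewrite /piece_rel -natrD; congr _%:R.
  case uv: (short_up u v); case vu: (short_up v u); rewrite ?andbF ?andbT ?orbF ?addn0 //.
  have /and3P[Guv a1 _] := uv; have /and3P[_ a2 _] := vu.
  by rewrite (ancestor_anti rk a1 a2) GI in Guv.
suff -> : A = (\sum_(v in Q) up v)%:R by ring.
rewrite /A exchange_big /= natr_sum (big_setID Q) /= (setIidPr sQN) [X in _ + X]big1 ?addr0.
  apply: eq_bigr => v vQ; rewrite vQ /= /up -sum1_card natr_sum.
  rewrite (bigID (fun u => short_up u v)) /= [X in _ + X]big1 ?addr0; last first.
    by move=> u /andP[_ /negPf->].
  rewrite (eq_bigl (fun u => short_up u v)); last first.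
    by move=> u; case uv: (short_up u v); rewrite ?andbF ?andbT // (hN u v).
  rewrite [RHS](eq_bigl (fun u => short_up u v)); last by move=> u; rewrite inE.
  by apply: eq_bigr => u ->.
by move=> v; rewrite inE => /andP[/negPf->]; rewrite big1.
Qed.

End ShortEdges.

(** * Missing edges of graphs without long cycles *)

Lemma exclusive_sum_le (T : Type) (s : seq T) (f : pred T) :
  pairwise (fun a b => ~~ (f a && f b)) s -> (\sum_(a <- s) f a <= has f s)%N.
Proof.
elim: s => [|a s IHs] /=; first by rewrite big_nil.
case/andP=> af pw; rewrite big_cons; case fa: (f a); last exact: IHs.
suff : ~~ has f s by move=> nh; have := IHs pw; rewrite (negPf nh) leqn0 => /eqP->.
rewrite -all_predC; apply: sub_all af => b /=; by rewrite fa.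
Qed.

Lemma sum_card_disjoint (V : finType) (T : Type) (F : T -> {set V}) (qs : seq T) :
  pairwise (fun a b => [disjoint F a & F b]) qs ->
  (\sum_(q <- qs) #|F q| <= #|V|)%N.
Proof.
move=> pw; have -> : (\sum_(q <- qs) #|F q| = \sum_(v : V) \sum_(q <- qs) (v \in F q))%N.
  rewrite exchange_big; apply: eq_bigr => q _ /=.
  by rewrite -sum1_card big_mkcond.
rewrite -sum1_card; apply: leq_sum => v _.
apply: leq_trans (exclusive_sum_le _) (leq_b1 _).
apply: sub_pairwise pw => a b dab; apply/negP=> /andP[va].
by rewrite (disjointFr dab va).
Qed.

Lemma sum_cover_le (V : finType) (T : Type) (F : T -> {set V}) (qs : seq T) (f : V -> nat) :
  (\sum_(v in \bigcup_(q <- qs) F q) f v <= \sum_(q <- qs) \sum_(v in F q) f v)%N.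
Proof.
elim: qs => [|q qs IHqs]; first by rewrite !big_nil big_set0.
rewrite !big_cons; apply: leq_trans (leq_add (leqnn _) IHqs).
rewrite (big_setID (F q)) /= setUK leq_add2l.
rewrite big_mkcond [leqRHS]big_mkcond /=; apply: leq_sum => v _; rewrite !inE.
by case: (v \in F q) => //=; case: ifP.
Qed.

Section PieceWitness.
Variables (R : archiRealFieldType) (V : finType) (G : rel V) (par : V -> V) (r : V -> nat).
Hypotheses (GC : symmetric G) (GI : irreflexive G) (rk : is_rank par r).
Implicit Types (a b : {set V} * option V).
Variables (L m : nat) (d theta gam : R) (qs : seq ({set V} * option V)).
Local Notation e := (@ecount R V).
Local Notation N a := (a.1 :|: near_part par r L a).
Local Notation g a := (piece_rel G par r L a.1).

Hypotheses (d0 : 0 < d) (Ld : L%:R <= d) (theta1 : theta < 1) (Lm : (L <= m)%N).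
Hypothesis pw : pairwise (fun a b : {set V} * option V => [disjoint a.1 & b.1]) qs.
Hypothesis sz : all (fun a : {set V} * option V => m <= #|a.1| <= m.*2)%N qs.
Hypothesis hg : {in qs, forall a, hangs (ancestor par) a.1 a.2}.

(** Measures the average degree of the piece graph by [#|a.1|] alone; the near part adds at most [L]
    vertices, few compared with [m] in the application. *)
Definition good_piece (a : {set V} * option V) :=
  (1 - theta) * d * #|a.1|%:R <= 2 * (\sum_(v in a.1) up G par r L v)%:R.
Local Notation gs := [seq a <- qs | good_piece a].

(** Averaging: twice the sum of [up] is at most [(1 - theta) * d] per vertex of a bad piece and
    [2 * d] per vertex of a good one, and the leftover adds at most [2 * delta * d * #|V|]. With
    [theta = 8 * delta] the good pieces must make up the difference. *)
Lemma good_pieces_cover (delta : R) :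
    delta = theta / 8 -> (#|~: \bigcup_(a <- qs) a.1| <= m)%N ->
    m%:R <= delta * #|V|%:R ->
    (1 - 2 * delta) * d * #|V|%:R <= 2 * (\sum_v up G par r L v)%:R ->
  theta / 4 * #|V|%:R <= (\sum_(a <- gs) #|a.1|)%:R.
Proof.
move=> deltaE rest mV upV.
pose U (a : {set V} * option V) := (\sum_(v in a.1) up G par r L v)%N.
have le1 : (\sum_v up G par r L v <= \sum_(a <- qs) U a + m * L)%N.
  rewrite (bigID (mem (\bigcup_(a <- qs) a.1))) /= leq_add ?sum_cover_le //.
  apply: (@leq_trans (\sum_(v in ~: \bigcup_(a <- qs) a.1) L)%N).
    rewrite (eq_bigl (mem (~: \bigcup_(a <- qs) a.1))) => [|v]; last by rewrite !inE.
    by apply: leq_sum => v _; apply: up_le.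
  by rewrite sum_nat_const leq_mul2r rest orbT.
have le2 : 2 * (\sum_(a <- qs) U a)%:R <=
    (1 - theta) * d * (\sum_(a <- qs) #|a.1|)%:R + 2 * d * (\sum_(a <- gs) #|a.1|)%:R.
  have -> : (\sum_(a <- gs) #|a.1|)%:R = \sum_(a <- qs) (if good_piece a then #|a.1|%:R else 0) :> R.
    by rewrite natr_sum big_filter big_mkcond.
  rewrite !natr_sum !mulr_sumr -big_split /=.
  rewrite big_seq [leRHS]big_seq; apply: ler_sum => a aqs.
  have Ua : (U a)%:R <= d * #|a.1|%:R.
    apply: (@le_trans _ _ (L%:R * #|a.1|%:R)); last by rewrite ler_wpM2r.
    rewrite -natrM ler_nat mulnC -sum_nat_const; apply: leq_sum => v _; exact: up_le.
  have : 0 <= (1 - theta) * d * #|a.1|%:R.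
    by rewrite !mulr_ge0 ?ler0n ?subr_ge0 // ltW.
  case: ifP => [_|/negbT]; first by move: Ua; lra.
  by rewrite /good_piece -ltNge -/(U a) mulr0 addr0 => /ltW.
have le3 : (1 - theta) * d * (\sum_(a <- qs) #|a.1|)%:R <= (1 - theta) * d * #|V|%:R.
  rewrite ler_wpM2l ?ler_nat ?(sum_card_disjoint (F := fst)) //.
  by rewrite mulr_ge0 ?subr_ge0 // ltW.
have le4 : 2 * (m%:R * L%:R) <= 2 * delta * d * #|V|%:R.
  have : m%:R * L%:R <= delta * #|V|%:R * d by apply: ler_pM.
  by lra.
have le5 : 2 * (\sum_v up G par r L v)%:R <= 2 * (\sum_(a <- qs) U a)%:R + 2 * (m%:R * L%:R) :> R.
  by have := le1; rewrite -(ler_nat R) natrD natrM; lra.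
by rewrite -(ler_pM2l d0); move: le2 le3 le4 le5 upV; rewrite deltaE; lra.
Qed.

Definition piece_witness (w : set_code V) : rel V := fun u v =>
  has (fun a => g a u v &&
    let q := (a.1, near_part par r L a) in
    ((u \in decode1 q w) && (v \in decode2 q w) || (v \in decode1 q w) && (u \in decode2 q w))) gs.

Lemma piece_witnessC w : symmetric (piece_witness w).
Proof. by move=> u v; apply: eq_has => a /=; rewrite piece_relC orbC. Qed.

Lemma piece_witness_sub w : subrel (piece_witness w) G.
Proof. by move=> u v /hasP[a _ /andP[+ _]]; apply: piece_rel_sub. Qed.

(** One code serves all good pieces. A piece contributes [gam * #|N a| ^ 2], at least
    [gam * m * #|a.1|], and contributions of different pieces add up. *)
Lemma piece_witness_exists (h : rel V) :
    symmetric h -> 0 < gam ->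
    {in gs, forall a, exists X Y : {set V}, [/\ X \subset N a, Y \subset N a,
       gam * #|N a|%:R ^+ 2 <= e (g a) X Y & forall x y, x \in X -> y \in Y -> ~~ h x y]} ->
  exists w, (forall u v, piece_witness w u v -> ~~ h u v) /\
    gam * m%:R * (\sum_(a <- gs) #|a.1|)%:R <= e (piece_witness w) setT setT.
Proof.
move=> hC gam0 ex.
pose toq (a : {set V} * option V) := (a.1, near_part par r L a).
have gsq a : a \in gs -> a \in qs by rewrite mem_filter => /andP[].
pose pr (q : {set V} * {set V}) X Y := gam * #|q.1 :|: q.2|%:R ^+ 2 <= e (piece_rel G par r L q.1) X Y /\
  forall x y, x \in X -> y \in Y -> ~~ h x y.
have pwgs : pairwise (fun a b : {set V} * option V => [disjoint a.1 & b.1]) gs.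
  exact: (subseq_pairwise (filter_subseq _ _)).
have [|q|q|w wP] := @encode V [seq toq a | a <- gs] pr.
- by rewrite pairwise_map; apply: sub_pairwise pwgs.
- case/mapP=> a ags ->; split; last exact: near_part_disjoint.
  have /andP[ma _] := allP sz a (gsq a ags).
  by apply: leq_trans (near_part_card L rk a) (leq_trans Lm ma).
- case/mapP=> a ags ->; have [X [Y [sX sY dXY nh]]] := ex a ags.
  by exists X, Y.
exists w; split.
  move=> u v /hasP[a ags /andP[_]] /=.
  have [_ nh] := wP (toq a) (map_f toq ags).
  by case/orP=> /andP[u1 v2]; [|rewrite hC]; apply: nh.
apply: (@le_trans _ _ (\sum_(a <- gs) e (g a) (decode1 (toq a) w) (decode2 (toq a) w))).
  rewrite natr_sum mulr_sumr big_seq [leRHS]big_seq; apply: ler_sum => a ags.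
  have [le _] := wP (toq a) (map_f toq ags); apply: le_trans le.
  have /andP[ma _] := allP sz a (gsq a ags).
  rewrite -mulrA ler_pM2l // expr2 -!natrM ler_nat; apply: leq_mul.
    by apply: leq_trans ma _; rewrite subset_leq_card ?subsetUl.
  by rewrite subset_leq_card ?subsetUl.
have -> : \sum_(a <- gs) e (g a) (decode1 (toq a) w) (decode2 (toq a) w) =
  \sum_u \sum_v \sum_(a <- gs) ([&& u \in decode1 (toq a) w, v \in decode2 (toq a) w & g a u v])%:R.
  rewrite (eq_bigr (fun a => \sum_u \sum_v
     ([&& u \in decode1 (toq a) w, v \in decode2 (toq a) w & g a u v])%:R)).
    by rewrite exchange_big; apply: eq_bigr => u _; rewrite exchange_big.
  move=> a _; rewrite -[decode1 _ _]setTI -[decode2 _ _]setTI ecountI setTI setTI /ecount.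
  by apply: eq_big => [u|u _]; rewrite ?inE //; apply: eq_bigl => v; rewrite inE.
rewrite /ecount [leRHS](eq_bigl xpredT) => [|u]; last by rewrite inE.
apply: ler_sum => u _; rewrite [leRHS](eq_bigl xpredT) => [|v]; last by rewrite inE.
apply: ler_sum => v _; rewrite -natr_sum ler_nat.
(* An edge lies in only one piece graph: it has a unique lower end, and the pieces are disjoint. *)
apply: leq_trans (exclusive_sum_le _) _.
  apply: sub_pairwise pwgs => a b /= dab; apply/negP=> /andP[/and3P[_ _ ga] /and3P[_ _ gb]].
  have nodup x : x \in a.1 -> x \in b.1 -> False by move=> xa; rewrite (disjointFr dab xa).
  case/orP: ga => /andP[xa /and3P[Guv anc1 _]]; case/orP: gb => /andP[xb /and3P[_ anc2 _]].
  - exact: nodup xa xb.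
  - by have := ancestor_anti rk anc1 anc2 => E; rewrite E GI in Guv.
  - by have := ancestor_anti rk anc1 anc2 => E; rewrite E GI in Guv.
  - exact: nodup xa xb.
rewrite /piece_witness; case: hasP => [[a ags /and3P[ua va ga]]|_]; last exact: leq0n.
rewrite (_ : has _ _) //; apply/hasP; exists a => //.
by rewrite ga /= ua va.
Qed.

End PieceWitness.

Lemma ecount_prod (R : numDomainType) (V : finType) (g : rel V) :
  ecount R g setT setT = (\sum_u \sum_v g u v)%:R.
Proof.
rewrite /ecount natr_sum; apply: eq_big => [u|u _]; rewrite ?inE //.
by rewrite natr_sum; apply: eq_bigl => v; rewrite inE.
Qed.

(* S depends on the forest but not on h, so that a union bound over the pairs
   (par, w) applies. *)
Lemma edge_witness (R : archiRealFieldType) (c : R) : 0 < c < 1 ->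
  exists del K : R, [/\ 0 < del, 0 < K &
    forall (V : finType) (G : rel V) (par : V -> V) (r : V -> nat) (d : R),
      symmetric G -> irreflexive G -> is_rank par r -> K <= d ->
      d * #|V|%:R = ecount R G setT setT ->
    exists S : set_code V -> rel V, (forall w, symmetric (S w) /\ subrel (S w) G) /\
      forall h : rel V, symmetric h ->
        (forall v, par v = v \/ h v (par v)) ->
        (forall u v, h u v -> ancestor par u v || ancestor par v u) ->
        (forall s, (3 <= size s)%N -> ucycle h s -> (size s)%:R < (1 - c) * d) ->
      exists w, (forall u v, S w u v -> ~~ h u v) /\
        del * (d * #|V|%:R) <= ecount R (S w) setT setT].
Proof.
move=> /andP[c0 c1].
pose theta := c / 8; have theta0 : 0 < theta by rewrite divr_gt0.
pose delta := theta / 8; have delta0 : 0 < delta by rewrite divr_gt0.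
(* Pieces will have at least [M * L] vertices, so the at most [L] vertices of the near part are at
   most a fraction [c / 8] of the piece. *)
pose M := (Num.truncn (8 / c)).+1.
have M8 : 8 <= c * M%:R.
  have /andP[_ lt] := Num.Theory.truncn_itv (ltW (divr_gt0 (ltr0Sn _ _) c0) : 0 <= 8 / c).
  by rewrite mulrC -ler_pdivrMr // ltW.
have MR : (0 : R) < M%:R by rewrite ltr0n.
have M1 : (1 : R) <= M%:R by rewrite ler1n.
(* Serves both uses of the dense case: a piece with its near part has at most [6 * M * d] vertices,
   and an undivided vertex set fewer than [2 * M * d / delta]. *)
pose beta := delta / (12 * M%:R).
have beta0 : 0 < beta by rewrite divr_gt0 // mulr_gt0.
have betaM : beta * (12 * M%:R) = delta by rewrite /beta divfK // gt_eqF // mulr_gt0.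
have delta1 : delta < 1 by rewrite /delta /theta; lra.
have beta1 : beta <= 1.
  by rewrite ler_pdivrMr ?mulr_gt0 // mul1r; move: delta1 M1; clear; lra.
have [||gam [n0 [gam0 n00 dense]]] := @dense_long_cycle R (c / 2) beta.
- by rewrite divr_gt0 //=; lra.
- by rewrite beta0.
exists (Order.min delta (Order.min gam (gam * theta / 4))), (n0 + 3).
split.
- by rewrite !lt_min delta0 gam0 !divr_gt0 // mulr_gt0.
- by rewrite addr_gt0.
move=> V G par r d GC GI rk Kd dG; set del := Order.min _ _.
have del1 : del <= delta by rewrite ge_min lexx.
have del2 : del <= gam by rewrite !ge_min lexx orbT.
have del3 : del <= gam * theta / 4 by rewrite !ge_min lexx !orbT.
have d3 : 3 <= d by move: Kd n00; clear; lra.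
have d0 : 0 < d by apply: lt_le_trans d3.
pose L := Num.truncn d.
have /andP[Ld dL] : L%:R <= d < L.+1%:R by apply: Num.Theory.truncn_itv; apply: ltW.
have L2 : (1 < L)%N.
  by rewrite -ltnS -(ltr_nat R); apply: le_lt_trans dL; move: d3; clear; lra.
have n0' : 0 <= d * #|V|%:R by rewrite mulr_ge0 // ltW.
have dle (x : R) : del <= x -> del * (d * #|V|%:R) <= x * (d * #|V|%:R).
  by move=> lex; rewrite ler_wpM2r.
(* Every edge of [G] is nonvertical, long or short. Nonvertical edges are missing from [h] by
   normality and long ones because they close long cycles; if neither kind is frequent, most edges
   are short. *)
have [big|small1] := leP (delta * (d * #|V|%:R)) (ecount R (nonvertical G par) setT setT).
  exists (fun=> nonvertical G par); split.
    by move=> _; split; [apply: nonverticalC|move=> u v /and3P[]].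
  move=> h hC hpar hver _; exists (set0, set0, set0, set0); split; last first.
    exact: le_trans (dle _ del1) big.
  move=> u v /and3P[_ nuv nvu]; apply/negP=> /hver.
  by rewrite (negPf nuv) (negPf nvu).
have [big|small2] := leP (delta * (d * #|V|%:R)) (ecount R (long G par r L) setT setT).
  exists (fun=> long G par r L); split.
    by move=> _; split; [apply: longC|move=> u v /andP[]].
  move=> h hC hpar hver nocyc; exists (set0, set0, set0, set0); split; last first.
    exact: le_trans (dle _ del1) big.
  have key u v : ancestor par u v -> (L <= r v - r u)%N -> ~~ h u v.
    move=> anc le; apply/negP=> huv.
    have [s [s3 us ss]] := long_edge_cycle hC rk hpar anc huv (leq_trans L2 le).
    have := nocyc s s3 us; rewrite ss ltNge => /negP; apply.
    apply: (@le_trans _ _ d); first by rewrite ger_pMl // gerBl ltW.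
    by apply: ltW; apply: lt_le_trans dL _; rewrite ler_nat.
  move=> u v /andP[_ /orP[]/andP[anc le]]; first exact: key.
  by rewrite hC; apply: key.
have V0 : (0 : R) < #|V|%:R.
  rewrite ltr0n; case: (posnP #|V|) => // cV; move: small1.
  by rewrite cV !mulr0 ltNge ecount_ge0.
have upV : (1 - 2 * delta) * d * #|V|%:R <= 2 * (\sum_v up G par r L v)%:R.
  have le : (\sum_u \sum_v G u v <= \sum_u \sum_v nonvertical G par u v +
      \sum_u \sum_v long G par r L u v + (\sum_v up G par r L v).*2)%N.
    have upE : (\sum_v up G par r L v = \sum_u \sum_v short_up G par r L u v)%N.
      rewrite exchange_big; apply: eq_bigr => v _ /=.
      by rewrite /up -sum1_card big_mkcond; apply: eq_bigr => u _; rewrite inE; case: ifP.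
    have upE' : (\sum_v up G par r L v = \sum_u \sum_v short_up G par r L v u)%N.
      by rewrite upE exchange_big.
    rewrite -addnn {1}upE upE' -!big_split /=; apply: leq_sum => u _ /=.
    by rewrite -!big_split /=; apply: leq_sum => v _ /=; apply: edge_cases.
  move: le; rewrite -(ler_nat R) -muln2 !natrD natrM -!ecount_prod -dG.
  by move: small1 small2; clear; lra.
have dV : d <= #|V|%:R.
  rewrite -(ler_pM2r V0) dG; apply: le_trans (ecount_le _ _ _) _.
  by rewrite cardsT.
pose m := (M * L.+1)%N.
have dm : d <= m%:R.
  apply: le_trans (ltW dL) _; rewrite ler_nat leq_pmull //.
have mub : m%:R <= 2 * M%:R * d.
  rewrite natrM -natr1; have := ler_wpM2l (ltW MR) Ld.
  by have := ler_wpM2l (ltW MR) d3; move: M1; clear; lra.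
have n0d (N : nat) : d <= N%:R -> n0 <= N%:R by move: Kd n00; clear; lra.
(* The factor [1 - c / 2] is lost twice: in the average degree of the dense graph and in the cycle
   length. *)
have cc : (1 - c) * d <= (1 - c / 2) * ((1 - c / 2) * d).
  have : 0 <= c * c * d by rewrite !mulr_ge0 // ltW.
  by clear; lra.
(* When [V] has only [O(d)] vertices, [G] itself is dense and need not be cut into pieces. *)
have [mV|Vm] := leP m%:R (delta * #|V|%:R); last first.
  pose S (w : set_code V) : rel V := fun u v =>
    G u v && ((u \in w.1.1.1) && (v \in w.1.1.2) || (v \in w.1.1.1) && (u \in w.1.1.2)).
  exists S; split.
    by move=> w; split; [move=> u v; rewrite /S GC orbC|move=> u v /andP[]].
  move=> h hC _ _ nocyc.
  have [/existsP[X /existsP[Y /andP[dXY /forall_inP nh]]]|] :=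
    boolP [exists X : {set V}, exists Y : {set V},
     (gam * #|[set: V]|%:R ^+ 2 <= ecount R G X Y) &&
     [forall x in X, forall y in Y, ~~ h x y]].
    exists (X, Y, set0, set0); split.
      have nh' u v : u \in X -> v \in Y -> ~~ h u v.
        by move=> uX vY; have /forall_inP := nh u uX; apply.
      move=> u v /andP[_ /= /orP[]/andP[xX yY]]; first exact: nh'.
      by rewrite hC; apply: nh'.
    apply: le_trans (dle _ del2) _; apply: le_trans (_ : gam * #|V|%:R ^+ 2 <= _).
      by rewrite ler_pM2l // expr2 ler_pM2r.
    rewrite cardsT in dXY; apply: le_trans dXY _.
    have := @ecountI R V G setT setT X Y; rewrite !setTI => ->.
    apply: ecount_subrel => u v /and3P[uX vY Guv].
    by apply/andP; split=> //; apply/orP; left; apply/andP.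
  rewrite negb_exists => /forallP nwit; exfalso.
  have [||||s [s3 us les]] := dense V G h setT ((1 - c / 2) * d) GC GI hC.
  - by rewrite cardsT; apply: n0d.
  - rewrite cardsT; apply: (@le_trans _ _ (1 / 2 * d)); last first.
      by rewrite ler_wpM2r ?ltW //; move: c1; clear; lra.
    have := ltW Vm; rewrite -betaM -(ler_pM2l (_ : 0 < 12 * M%:R)) ?mulr_gt0 //.
    move=> le1; rewrite -(ler_pM2l (_ : 0 < 12 * M%:R)) ?mulr_gt0 //.
    have Md0 : 0 < M%:R * d by rewrite mulr_gt0.
    have : beta * (12 * M%:R) * #|V|%:R <= 2 * M%:R * d.
      by rewrite betaM; apply: le_trans mub; apply: ltW.
    by move: Md0; clear; lra.
  - rewrite cardsT -dG; apply: ler_wpM2r; first exact: ltW.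
    by rewrite ger_pMl // gerBl divr_ge0 // ltW.
  - move=> X Y _ _ dXY; have := nwit X; rewrite negb_exists => /forallP/(_ Y).
    rewrite dXY /= negb_forall_in => /exists_inP[x xX].
    rewrite negb_forall_in => /exists_inP[y yY]; rewrite negbK => hxy.
    by exists x, y.
  have := nocyc s s3 us; rewrite ltNge => /negP; apply; exact: le_trans cc les.
have m0 : (0 < m)%N by rewrite muln_gt0.
have [qs [pw sz hg rest]] := @piece_decomposition V (ancestor par) (@ancestor_refl _ par)
  (@ancestor_trans _ par) (fun u v => @ancestor_anti _ par r u v rk) (@ancestor_chain _ par) m m0.
have Lm : (L <= m)%N by rewrite (leq_trans (leqnSn L)) // leq_pmull.
exists (piece_witness G par r L d theta qs); split.
  by move=> w; split; [apply: piece_witnessC|apply: piece_witness_sub].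
move=> h hC _ _ nocyc.
have theta1 : theta < 1 by rewrite /theta; move: c1; clear; lra.
have [|w [nh le]] := @piece_witness_exists R V G par r GI rk L m d theta gam qs Lm pw sz h hC gam0.
  move=> a; rewrite mem_filter => /andP[good aqs].
  set P := near_part par r L a.
  have /andP[ma am] := allP sz a aqs.
  have PL : (#|P| <= L)%N by apply: near_part_card.
  have cN : #|a.1 :|: P|%:R <= #|a.1|%:R + L%:R :> R.
    by rewrite -natrD ler_nat cardsU leq_subLR (leq_trans (leq_add (leqnn _) PL)) // leq_addl.
  have aN : #|a.1|%:R <= #|a.1 :|: P|%:R :> R by rewrite ler_nat subset_leq_card ?subsetUl.
  have maR : m%:R <= #|a.1|%:R :> R by rewrite ler_nat.
  have [/existsP[X /existsP[Y /and4P[sX sY dXY /forall_inP nh]]]|] :=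
    boolP [exists X : {set V}, exists Y : {set V}, [&& X \subset a.1 :|: P, Y \subset a.1 :|: P,
     gam * #|a.1 :|: P|%:R ^+ 2 <= ecount R (piece_rel G par r L a.1) X Y &
     [forall x in X, forall y in Y, ~~ h x y]]].
    exists X, Y; split=> // x y xX yY.
    by have /forall_inP := nh x xX; apply.
  rewrite negb_exists => /forallP nwit; exfalso.
  have [||||s [s3 us les]] := dense V (piece_rel G par r L a.1) h (a.1 :|: P) ((1 - c / 2) * d)
     (piece_relC _ _ _ _ _) (piece_relI _ _ _ GI _) hC.
  - by apply: n0d; apply: le_trans dm (le_trans maR aN).
  - apply: (@le_trans _ _ (1 / 2 * d)); last first.
      by rewrite ler_wpM2r ?ltW //; move: c1; clear; lra.
    have am' : #|a.1|%:R <= 2 * m%:R :> R by rewrite -natrM ler_nat mul2n.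
    have Lm' : L%:R <= m%:R :> R by rewrite ler_nat.
    have le6 : #|a.1 :|: P|%:R <= 6 * M%:R * d.
      by move: am' Lm' cN mub; clear; lra.
    have := ler_wpM2l (ltW beta0) le6; have := ler_wpM2r (ltW d0) (ltW delta1).
    by rewrite -betaM; clear; lra.
  - rewrite ecount_piece //.
    + apply: le_trans good.
      suff le9 : (1 - c / 2) * #|a.1 :|: P|%:R <= (1 - theta) * #|a.1|%:R.
        by have := ler_wpM2r (ltW d0) le9; clear; lra.
      have ML : M%:R * L%:R <= #|a.1|%:R :> R.
        by apply: le_trans maR; rewrite -natrM ler_nat leq_mul2l leqnSn orbT.
      have L8 : 8 * L%:R <= c * #|a.1|%:R.
        have := ler_wpM2l (ltW c0) ML; have := ler_wpM2r (ler0n R L) M8; clear; lra.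
      have c2 : 0 <= 1 - c / 2 by move: c1; clear; lra.
      apply: le_trans (ler_wpM2l c2 cN) _.
      have := ler_wpM2l c2 L8; have c0' := ltW c0; have : 0 <= c * c * #|a.1|%:R by rewrite !mulr_ge0.
      have : 0 <= c * #|a.1|%:R by rewrite mulr_ge0.
      by rewrite /theta; clear; lra.
    + by move=> u v vQ su; apply: (near_part_short rk (hg a aqs) vQ su).
    + exact: subsetUl.
  - move=> X Y sX sY dXY; have := nwit X; rewrite negb_exists => /forallP/(_ Y).
    rewrite sX sY dXY /= negb_forall_in => /exists_inP[x xX].
    rewrite negb_forall_in => /exists_inP[y yY]; rewrite negbK => hxy.
    by exists x, y.
  have := nocyc s s3 us; rewrite ltNge => /negP; apply; exact: le_trans cc les.
exists w; split => //; apply: le_trans le.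
have cov := @good_pieces_cover R V G par r rk L m d theta qs d0 Ld theta1 pw delta
  (erefl _) (ltnW rest) mV upV.
apply: le_trans (dle _ del3) _.
have : gam * (d * (theta / 4 * #|V|%:R)) <=
    gam * (m%:R * (\sum_(a <- [seq a <- qs | good_piece G par r L d theta a]) #|a.1|)%:R).
  rewrite ler_pM2l //; apply: ler_pM => //; first exact: ltW.
  by apply: mulr_ge0 => //; apply: divr_ge0 => //; apply: ltW.
by clear; lra.
Qed.

(** * The random subgraph *)

Require Import Defs.
From mathcomp Require Import all_classical all_reals all_analysis.
From mathcomp Require Import fintype finset.
Import Order.TTheory GRing.Theory Num.Theory.
Import numFieldNormedType.Exports.
Local Open Scope ring_scope.

Section RandomSubgraph.
Variables (R : realType) (T : finType) (G : sgraph T) (p : R).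
Hypothesis p01 : 0 <= p <= 1.
Implicit Types (F A B : {set {set T}}).

Definition weight F : R := \prod_(e in edges G) (if e \in F then p else 1 - p).

Lemma weight_ge0 F : 0 <= weight F.
Proof.
have /andP[p0 p1] := p01.
by apply: prodr_ge0 => e _; case: ifP => // _; rewrite subr_ge0.
Qed.

(** Independence: the probability that all of [A] is kept and all of [B] is deleted factorises. *)
Lemma weight_sum A B : A \subset edges G -> B \subset edges G -> [disjoint A & B] ->
  \sum_(F in powerset (edges G) | (A \subset F) && [disjoint B & F]) weight F =
  p ^+ #|A| * (1 - p) ^+ #|B|.
Proof.
move=> sA sB dAB; have dBA : [disjoint B & A] by rewrite disjoint_sym.
(* Weights for keeping and deleting [e]. Zeros encode the constraints: sets outside [edges G] or in
   [B] cannot be kept, those in [A] cannot be deleted. Expanding the product of [a e + b e] gives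
   the sum over [F]. *)
pose a (e : {set T}) : R := if (e \in edges G) && (e \notin B) then p else 0.
pose b (e : {set T}) : R := if e \in edges G then (if e \in A then 0 else 1 - p) else 1.
transitivity (\prod_e (a e + b e)).
  rewrite bigA_distr /= big_mkcond /=; apply: eq_bigr => F _; rewrite powersetE.
  case: ifP => [/and3P[sF sAF dBF]|].
    rewrite /weight big_mkcond /=; apply: eq_bigr => e _; rewrite /a /b.
    case: ifP => eE; last first.
      by rewrite ifN //; apply/negP=> /(subsetP sF); rewrite eE.
    case: ifP => eF; first by rewrite (disjointFl dBF eF).
    by rewrite ifN //; apply/negP=> /(subsetP sAF); rewrite eF.
  move=> /negbT; rewrite !negb_and => nF; apply/esym/eqP/prodf_eq0.
  case/or3P: nF => [/subsetPn[e eF eE]|/subsetPn[e eA eF]|].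
  - by exists e => //; rewrite eF /a (negPf eE).
  - by exists e => //; rewrite (negPf eF) /b (subsetP sA) // eA.
  - rewrite disjoint_subset => /subsetPn[e eB]; rewrite inE negbK => eF.
    by exists e => //; rewrite eF /a eB andbF.
rewrite -!prodr_const (bigID (mem A)) /=; congr (_ * _).
  apply: eq_bigr => e eA; rewrite /a /b (subsetP sA e eA) eA (disjointFr dAB eA) /=.
  by rewrite addr0.
rewrite (bigID (mem B)) /= [X in _ * X]big1 ?mulr1; last first.
  move=> e /andP[eA eB]; rewrite /a /b (negPf eA) eB andbT.
  by case: ifP => _; rewrite ?add0r // addrC subrK.
apply: eq_big => [e|e /andP[eA eB]].
  by case eB: (e \in B); rewrite ?andbF // (disjointFr dBA eB).
by rewrite /a /b (subsetP sB e eB) eB (negPf eA) add0r.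
Qed.

Lemma weight_total : \sum_(F in powerset (edges G)) weight F = 1.
Proof.
have := @weight_sum finset.set0 finset.set0 (sub0set _) (sub0set _) _.
rewrite cards0 !expr0 mulr1 => <- //; last by rewrite -setI_eq0 finset.set0I.
by apply: eq_bigl => F; rewrite sub0set -setI_eq0 finset.set0I eqxx !andbT.
Qed.

Lemma Pr_subgraphC (P : sgraph T -> Prop) :
  Pr_subgraph G p P = 1 - Pr_subgraph G p (fun H => ~ P H).
Proof.
have := weight_total; rewrite (bigID (fun F => `[< P (keep_edges G F) >])) /=.
rewrite [X in _ + X](eq_bigl (fun F => (F \in powerset (edges G)) &&
   `[< ~ P (keep_edges G F) >])) => [|F]; last by rewrite asbool_neg.
rewrite /Pr_subgraph /weight; set x := \sum_(F in _ | _) _; set y := \sum_(F in _ | _) _.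
by move=> xy; lra.
Qed.

Lemma Pr_subgraph_ge0 (P : sgraph T -> Prop) : 0 <= Pr_subgraph G p P.
Proof. by apply: sumr_ge0 => F _; apply: weight_ge0. Qed.

Lemma Pr_subgraph_union (I : finType) (A B : I -> {set {set T}}) (Q : pred I)
    (P : sgraph T -> Prop) :
    (forall i, Q i -> [/\ A i \subset edges G, B i \subset edges G & [disjoint A i & B i]]) ->
    (forall F, F \subset edges G -> P (keep_edges G F) ->
       exists i, [/\ Q i, A i \subset F & [disjoint B i & F]]) ->
  Pr_subgraph G p P <= \sum_(i | Q i) p ^+ #|A i| * (1 - p) ^+ #|B i|.
Proof.
move=> ok cover; rewrite (eq_bigr (fun i => \sum_(F in powerset (edges G) |
   (A i \subset F) && [disjoint B i & F]) weight F)); last first.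
  by move=> i /ok[sA sB dAB]; rewrite weight_sum.
rewrite (exchange_big_dep (fun F => F \in powerset (edges G))) /=; last by move=> i F _ /andP[].
rewrite /Pr_subgraph big_mkcondr /=; apply: ler_sum => F FE.
have wge : 0 <= \sum_(i | Q i && ((F \in powerset (edges G)) &&
    ((A i \subset F) && [disjoint B i & F]))) weight F.
  by apply: sumr_ge0 => i _; apply: weight_ge0.
case: ifP => // /asboolP PF; rewrite powersetE in FE.
have [i [Qi sAF dBF]] := cover F FE PF.
rewrite (bigD1 i) /=; last by rewrite Qi powersetE FE sAF.
by rewrite lerDl; apply: sumr_ge0 => j _; apply: weight_ge0.
Qed.

End RandomSubgraph.

Section EdgeSets.
Variables (T : finType).

Definition edge_set (s : rel T) : {set {set T}} :=
  [set [set x.1; x.2] | x in [set y : T * T | s y.1 y.2]].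

Lemma eq_set2 (u v a b : T) : [set u; v] = [set a; b] ->
  (u == a) && (v == b) || (u == b) && (v == a).
Proof.
move=> /setP E; have := E u; have := E v; have := E a; have := E b.
rewrite !inE !eqxx ?orbT /= ![_ == u]eq_sym ![_ == v]eq_sym.
by case: (u == a); case: (u == b); case: (v == a); case: (v == b).
Qed.

Lemma edge_setP (s : rel T) u v : symmetric s -> ([set u; v] \in edge_set s) = s u v.
Proof.
move=> sC; apply/imsetP/idP => [[[a b]]|suv]; last by exists (u, v); rewrite ?inE.
by rewrite inE /= => sab /eq_set2/orP[]/andP[/eqP-> /eqP->] //; rewrite sC.
Qed.

Lemma edges_edge_set (G : sgraph T) : edges G = edge_set G.
Proof.
apply/setP=> e; rewrite inE; apply/existsP/imsetP => [[u /existsP[v /andP[Guv /eqP->]]]|[[u v]]].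
  by exists (u, v); rewrite ?inE.
by rewrite inE /= => Guv ->; exists u; apply/existsP; exists v; rewrite Guv /=.
Qed.

Lemma card_edge_set (s : rel T) : (\sum_u \sum_v s u v <= 2 * #|edge_set s|)%N.
Proof.
rewrite pair_big /= (partition_big (fun x : T * T => [set x.1; x.2]) xpredT) //=.
rewrite (bigID (mem (edge_set s))) /= [X in (_ + X)%N]big1 ?addn0; last first.
  move=> e ne; rewrite big1 // => x /eqP xe; apply/eqP; rewrite eqb0.
  by apply: contra ne => sx; rewrite -xe; apply/imsetP; exists x; rewrite ?inE.
rewrite mulnC -sum_nat_const.
apply: leq_sum => e /imsetP[[a b] _ ->] /=.
apply: (@leq_trans (\sum_(x in [set (a, b); (b, a)]) 1)%N); last first.
  by rewrite sum1_card cards2; case: (_ != _).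
rewrite big_mkcond [leqRHS]big_mkcond /=; apply: leq_sum => -[u v] _ /=.
rewrite !inE !xpair_eqE; case: eqP => //= /eq_set2 ->; exact: leq_b1.
Qed.

End EdgeSets.

(** * The union bound over forests and witnesses *)

Definition forest_edges (T : finType) (par : T -> T) : {set {set T}} :=
  [set [set v; par v] | v in [set v | par v != v]].

(** If two vertices had the same parent edge, each would be the parent of the other, which the ranks
    exclude. *)
Lemma card_forest_edges (T : finType) (par : T -> T) r : is_rank par r ->
  #|forest_edges par| = #|[set v | par v != v]|.
Proof.
move=> /forallP rk; apply: card_in_imset => v w; rewrite !inE => nv nw /eq_set2.
case/orP=> /andP[/eqP // vw /eqP wv].
have := rk v; have := rk w; rewrite (negPf nv) (negPf nw) wv -vw => /eqP-> /eqP.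
by move: (r v) => k; lia.
Qed.

(** The sum over all maps factorises into the product of [1 + p * degree G v]; then the inequality
    of arithmetic and geometric means applies. *)
Lemma sum_forest_weights (R : realType) (T : finType) (G : sgraph T) (p : R) : 0 <= p ->
  \sum_(par : {ffun T -> T}) \prod_v (if par v == v then 1 else if G v (par v) then p else 0)
  <= (1 + p * average_degree R G) ^+ #|T|.
Proof.
move=> p0; pose t v u : R := if u == v then 1 else if G v u then p else 0.
rewrite -(bigA_distr_bigA t).
have tE v : \sum_u t v u = 1 + p * (degree G v)%:R.
  rewrite (bigD1 v) //= {1}/t eqxx; congr (_ + _).
  rewrite /degree -sum1_card natr_sum mulr_sumr big_mkcond /= [RHS]big_mkcond /=.
  apply: eq_bigr => u _; rewrite inE /t.
  by case: eqP => [->|_] /=; rewrite ?adj_irr // mulr1.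
have [T0|T0] := posnP #|T|.
  by rewrite big1 ?T0 // => v; move: (fintype0 v T0).
have t0 v : 0 <= \sum_u t v u by rewrite tE addr_ge0 // mulr_ge0.
have [le _] := @leif_AGM R T predT (fun v => \sum_u t v u) (fun v _ => t0 v).
apply: le_trans le _; rewrite (eq_card (B := T)) //; apply: lerXn2r; rewrite ?nnegrE.
- by rewrite divr_ge0 // sumr_ge0.
- by rewrite addr_ge0 // mulr_ge0 // divr_ge0.
rewrite (eq_bigr _ (fun v _ => tE v)) big_split /= sumr_const -mulr_sumr -natr_sum.
rewrite mulrDl divff ?pnatr_eq0 -?lt0n // /average_degree mulrA.
by rewrite lexx.
Qed.

(** From [expR (a * x) >= (a * x / 2) ^+ 2 >= 64 * x] and [x >= 1]. *)
Lemma expR_decay (R : realType) (a : R) : 0 < a ->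
  exists2 K : R, 0 < K & forall x, K <= x -> 16 * (1 + x) * expR (- (a * x)) <= 2^-1.
Proof.
move=> a0; exists (Order.max 1 (256 / a ^+ 2)); first by rewrite lt_max ltr01.
move=> x; rewrite ge_max => /andP[x1 xa].
have ax : 256 <= a ^+ 2 * x by move: xa; rewrite ler_pdivrMr ?exprn_gt0 // mulrC.
rewrite expRN ler_pdivrMr ?expR_gt0 //.
have ax0 : 0 <= a * x / 2 by rewrite divr_ge0 // mulr_ge0 ?ltW // (lt_le_trans ltr01).
have -> : expR (a * x) = expR (a * x / 2) ^+ 2 by rewrite expr2 -expRD; congr expR; lra.
have le : (a * x / 2) ^+ 2 <= expR (a * x / 2) ^+ 2.
  rewrite lerXn2r ?nnegrE ?expR_ge0 //; have := expR_ge1Dx (a * x / 2); lra.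
have : 256 * x <= a ^+ 2 * x * x by rewrite ler_wpM2r // (le_trans ler01).
move: le; rewrite expr2 [X in _ -> X -> _]/= ; lra.
Qed.

(** If there is no long cycle, some forest in [G_p] and some code give a set [B i] of missing edges;
    the union bound runs over all such pairs. *)
Lemma long_cycle_probability (R : realType) (c : R) : 0 < c < 1 ->
  exists2 K : R, 0 < K & forall (T : finType) (G : sgraph T) (p : R),
    0 <= p <= 1 -> K <= average_degree R G -> K <= p * average_degree R G ->
    1 - 2^-1 ^+ #|T| <= Pr_subgraph G p (has_cycle_ge ((1 - c) * average_degree R G)).
Proof.
move=> c01; have [del [K0 [del0 K00 wit]]] := edge_witness c01.
pose a := del / 2; have a0 : 0 < a by rewrite divr_gt0.
have [K1 K10 decay] := expR_decay a0.
exists (Order.max K0 K1); first by rewrite lt_max K00.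
move=> T G p p01; set d := average_degree R G; rewrite !ge_max => /andP[K0d _] /andP[_ K1pd].
have /andP[p0 p1] := p01.
have d0 : 0 < d by apply: lt_le_trans K0d.
have n0 : (0 < #|T|)%N.
  by rewrite lt0n; apply: contraTneq d0 => T0; rewrite /d /average_degree T0 invr0 mulr0 ltxx.
have dG : d * #|T|%:R = ecount R G finset.setT finset.setT.
  rewrite /d /average_degree divfK ?pnatr_eq0 -?lt0n // ecount_prod; congr _%:R.
  apply: eq_bigr => v _; rewrite /degree -sum1_card big_mkcond /=.
  by apply: eq_bigr => u _; rewrite inE; case: (G v u).
pose okpar (par : {ffun T -> T}) :=
  `[< exists r, is_rank par r >] && [forall v, (par v == v) || G v (par v)].
have exS (par : {ffun T -> T}) : exists S : set_code T -> rel T, okpar par ->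
    (forall w, symmetric (S w) /\ subrel (S w) G) /\
    forall h : rel T, symmetric h ->
        (forall v, par v = v \/ h v (par v)) ->
        (forall u v, h u v -> ancestor par u v || ancestor par v u) ->
        (forall s, (3 <= size s)%N -> ucycle h s -> (size s)%:R < (1 - c) * d) ->
      exists w, (forall u v, S w u v -> ~~ h u v) /\
        del * (d * #|T|%:R) <= ecount R (S w) finset.setT finset.setT.
  case okp: (okpar par); last by exists (fun=> adj G).
  have /andP[/asboolP[r rk] _] := okp.
  by have [S SP] := wit T G par r d (@adj_sym _ G) (@adj_irr _ G) rk K0d dG; exists S.
have [S SP] := choice exS.
pose A (i : {ffun T -> T} * set_code T) := forest_edges i.1.
pose B (i : {ffun T -> T} * set_code T) := edge_set (S i.1 i.2).
(* The constant drops from [del] to [a = del / 2] because [ecount] counts ordered pairs and [B i]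
   consists of unordered ones. *)
pose Q (i : {ffun T -> T} * set_code T) :=
  [&& okpar i.1, a * (d * #|T|%:R) <= #|B i|%:R & [disjoint A i & B i]].
have AE par : okpar par -> forest_edges par \subset edges G.
  move=> /andP[_ /forallP hG]; rewrite edges_edge_set; apply/subsetP=> e /imsetP[v].
  rewrite inE => nv ->; rewrite edge_setP; last exact: adj_sym.
  by have := hG v; rewrite (negPf nv).
have BE i : okpar i.1 -> B i \subset edges G.
  move=> okp; have [/(_ i.2)[SC SG] _] := SP i.1 okp.
  rewrite edges_edge_set; apply/subsetP=> e /imsetP[[u v]]; rewrite inE /= => /SG Guv ->.
  by rewrite edge_setP //; exact: adj_sym.
rewrite Pr_subgraphC // lerB //.
apply: (@le_trans _ _ (\sum_(i | Q i) p ^+ #|A i| * (1 - p) ^+ #|B i|)).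
  apply: Pr_subgraph_union => //.
    by move=> i /and3P[okp _ dAB]; rewrite AE ?BE.
  move=> F FE nocyc; pose h := keep_edges G F.
  have hC : symmetric h by apply: adj_sym.
  have [par [r [rk hpar hver]]] := normal_forest hC (@adj_irr _ h).
  have hG u v : h u v -> G u v by case/andP.
  have okp : okpar par.
    apply/andP; split; first by apply/asboolP; exists r.
    by apply/forallP=> v; case: (hpar v) => [->|/hG->]; rewrite ?eqxx ?orbT.
  have [SG SW] := SP par okp.
  have [s s3 us|w [nS big]] := SW h hC hpar hver.
    rewrite ltNge; apply/negP => le; apply: nocyc; by exists s.
  have [SC SGw] := SG w.
  have AF : forest_edges par \subset F.
    apply/subsetP=> e /imsetP[v]; rewrite inE => nv ->.
    by case: (hpar v) => [E|/andP[]//]; rewrite E eqxx in nv.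
  have BF : [disjoint B (par, w) & F].
    rewrite disjoint_subset; apply/subsetP=> e /imsetP[[u v]]; rewrite !inE /= => Suv ->.
    apply/negP=> eF; have /negP := nS u v Suv; apply.
    by rewrite /= /keep_adj (SGw _ _ Suv).
  exists (par, w); split=> //; rewrite /Q /= okp /=; apply/andP; split.
    have := card_edge_set (S par w); rewrite -(ler_nat R) natrM -ecount_prod.
    by move: big; rewrite /a /B /=; lra.
  by rewrite disjoint_sym; apply: disjointWr AF BF.
(* Bounds the probability that [B i] is missing: [(1 - p) ^+ #|B i| <= expR (- p * #|B i|)]. *)
pose E := expR (- (a * (p * d))) ^+ #|T|.
pose g (par : {ffun T -> T}) : R :=
  (\prod_v (if par v == v then 1 else if G v (par v) then p else 0)) * E.
have g0 par : 0 <= g par.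
  rewrite mulr_ge0 ?exprn_ge0 ?expR_ge0 // prodr_ge0 // => v _.
  by case: ifP => // _; case: ifP.
apply: (@le_trans _ _ (\sum_i g i.1)).
  rewrite big_mkcond /=; apply: ler_sum => i _; case: ifP => // /and3P[okp big _].
  rewrite ler_pM ?exprn_ge0 ?subr_ge0 //.
    have /andP[/asboolP[r rk] /forallP hG] := okp.
    rewrite /A (card_forest_edges rk) -prodr_const big_mkcond /= le_eqVlt; apply/orP; left.
    apply/eqP; apply: eq_bigr => v _; rewrite inE; have := hG v.
    by case: eqP => //= _ ->.
  apply: (@le_trans _ _ (expR (- p) ^+ #|B i|)).
    by rewrite lerXn2r ?nnegrE ?subr_ge0 ?expR_ge0 // expR_ge1Dx.
  rewrite /E -!expRM_natl ler_expR.
  have := ler_wpM2l p0 big; lra.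
rewrite -(pair_bigA _ (fun par (_ : set_code T) => g par)) /=.
have cardC : #|{: set_code T}|%:R = 16 ^+ #|T| :> R.
  have cS : #|{: {set T}}| = (2 ^ #|T|)%N.
    by rewrite -[X in (2 ^ X)%N]cardsT -card_powerset powersetT cardsT.
  rewrite !card_prod cS -!expnMn natrX; congr (_ ^+ _); by rewrite !natrM; lra.
rewrite (eq_bigr (fun par => g par * 16 ^+ #|T|)) => [|par _]; last first.
  by rewrite sumr_const -cardC mulr_natr; congr (_ *+ _); apply: eq_card.
rewrite -mulr_suml -mulr_suml.
apply: (@le_trans _ _ ((1 + p * d) ^+ #|T| * E * 16 ^+ #|T|)).
  rewrite ler_wpM2r ?exprn_ge0 // ler_wpM2r ?exprn_ge0 ?expR_ge0 //.
  exact: sum_forest_weights.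
rewrite /E -!exprMn; apply: lerXn2r; rewrite ?nnegrE ?invr_ge0 //.
  by rewrite !mulr_ge0 ?expR_ge0 // addr_ge0 // mulr_ge0 // ltW.
by rewrite mulrC mulrA; apply: decay.
Qed.

(** * Passage to the limit *)

Local Open Scope classical_set_scope.
Local Open Scope ring_scope.

Lemma Pr_subgraph_le (R : realType) (T : finType) (G : sgraph T) (p : R)
    (P P' : sgraph T -> Prop) : 0 <= p <= 1 -> (forall H, P H -> P' H) ->
  Pr_subgraph G p P <= Pr_subgraph G p P'.
Proof.
move=> p01 sP; rewrite /Pr_subgraph big_mkcondr [leRHS]big_mkcondr /=.
apply: ler_sum => F _; have w0 := weight_ge0 G p01 F.
case: ifP => [/asboolP/sP PF|_]; first by rewrite ifT //; apply/asboolP.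
by case: ifP.
Qed.

Lemma Pr_subgraph_le1 (R : realType) (T : finType) (G : sgraph T) (p : R)
    (P : sgraph T -> Prop) : 0 <= p <= 1 -> Pr_subgraph G p P <= 1.
Proof. by move=> p01; rewrite Pr_subgraphC // gerBl Pr_subgraph_ge0. Qed.

Lemma cvg_to1 (R : realType) (u : nat -> R) :
  (\forall n \near \oo, 1 - 2^-1 ^+ n <= u n <= 1) -> u n @[n --> \oo] --> (1 : R).
Proof.
move=> le; apply: (@squeeze_cvgr _ _ _ _ (fun n => 1 - 2^-1 ^+ n) (fun=> 1)) => //.
  rewrite -[X in _ --> X]subr0; apply: cvgB; first exact: cvg_cst.
  by apply: cvg_expr; rewrite ger0_norm ?invr_ge0 // invf_lt1 // ltr1n.
exact: cvg_cst.
Qed.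

Theorem theorem1p1 (R : realType) :
  (forall c : R, 0 < c ->
    exists2 K : R, 0 < K &
      forall (V : nat -> finType) (G : forall n : nat, sgraph (V n))
             (d p : nat -> R),
        (\forall n \near \oo,
          [/\ #|V n| = n, average_degree R (G n) = d n, K <= d n,
              0 <= p n <= 1 & K / d n <= p n]) ->
        Pr_subgraph (G n) (p n) (has_cycle_ge ((1 - c) * d n)) @[n --> \oo]
          --> (1 : R))
  /\
  (forall (V : nat -> finType) (G : forall n : nat, sgraph (V n))
          (d p : nat -> R),
    (\forall n \near \oo,
      [/\ #|V n| = n, average_degree R (G n) = d n & 0 <= p n <= 1]) ->
    p n * d n @[n --> \oo] --> +oo ->
    exists2 eps : nat -> R, eps n @[n --> \oo] --> (0 : R) &
      Pr_subgraph (G n) (p n) (has_cycle_ge ((1 - eps n) * d n)) @[n --> \oo]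
        --> (1 : R)).
Proof.
split=> [c c0|V G d p base pd].
  (* Values [c >= 1] are allowed, while the finite estimate needs a constant below 1; a smaller
     constant gives a longer cycle. *)
  pose c' := Order.min c (1 / 2).
  have [|K K0 main] := @long_cycle_probability R c'.
    by rewrite lt_min c0 gt_min; apply/andP; split; [|apply/orP; right]; lra.
  exists K => // V G d p hyp; apply: cvg_to1; near=> n.
  have [cV dE Kd p01 Kp] : [/\ #|V n| = n, average_degree R (G n) = d n, K <= d n,
              0 <= p n <= 1 & K / d n <= p n] by near: n.
  rewrite Pr_subgraph_le1 // andbT.
  have d0 : 0 < d n by apply: lt_le_trans Kd.
  have := main (V n) (G n) (p n) p01; rewrite dE cV => /(_ Kd) le.
  apply: le_trans (le _) _; first by rewrite -ler_pdivrMr.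
  apply: Pr_subgraph_le => // H [s [s3 us les]]; exists s; split=> //.
  by apply: le_trans les; rewrite ler_pM2r // lerB // ge_min lexx.
have ck (k : nat) : 0 < (k.+2%:R : R)^-1 < 1.
  by rewrite invr_gt0 ltr0n /= invf_lt1 ?ltr0n // ltr1n.
have exK (k : nat) : exists K : R, forall (T : finType) (G : sgraph T) (p : R),
    0 <= p <= 1 -> K <= average_degree R G -> K <= p * average_degree R G ->
    1 - 2^-1 ^+ #|T| <= Pr_subgraph G p (has_cycle_ge ((1 - k.+2%:R^-1) * average_degree R G)).
  by have [K _ KP] := long_cycle_probability (ck k); exists K.
have [K KP] := choice exK.
(* Diagonal choice: [eps n] is the least [1 / (k + 2)] with [k <= n] whose threshold [K k] has been
   reached at [n]. The shift by 2 keeps these values below 1, so the value 1 marks that no [k]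
   qualifies. *)
pose good n k := (K k <= d n) && (K k <= p n * d n).
pose eps n : R := \big[Order.min/1]_(k < n.+1 | good n k) k.+2%:R^-1.
have eps_le n k : good n k -> (k <= n)%N -> eps n <= k.+2%:R^-1.
  move=> gk kn; have kn' : (k < n.+1)%N by [].
  by apply: (bigmin_inf (Ordinal kn')).
have epsP n : eps n = 1 \/ exists2 k, good n k & eps n = k.+2%:R^-1.
  rewrite /eps; elim/big_rec: _ => [|k x gk IH]; first by left.
  by rewrite /Order.min; case: ifP => _; [right; exists k|].
have eps_ge0 n : 0 <= eps n.
  by case: (epsP n) => [->|[k _ ->]].
have goodE k : \forall n \near \oo, good n k.
  near=> n.
  have [cV dE /andP[p0 p1]] : [/\ #|V n| = n, average_degree R (G n) = d n &
     0 <= p n <= 1] by near: n.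
  have Kpd : K k <= p n * d n by near: n; move/cvgryPge: pd; apply.
  have d0 : 0 <= d n by rewrite -dE /average_degree divr_ge0.
  (* The bound on [p n * d n] passes to [d n] because [p n <= 1]. *)
  by rewrite /good Kpd andbT; apply: le_trans Kpd _; rewrite ler_piMl.
exists eps.
  apply/cvgrPdist_lt => e e0; near=> n.
  rewrite sub0r normrN ger0_norm //.
  pose k := (Num.truncn e^-1).
  have ke : k.+2%:R^-1 < e.
    rewrite -[ltRHS]invrK ltf_pV2 ?posrE ?invr_gt0 ?ltr0n //.
    by apply: lt_trans (Num.Theory.truncnS_gt _) _; rewrite ltr_nat.
  apply: le_lt_trans ke; apply: eps_le; first by near: n; apply: goodE.
  by near: n; apply: nbhs_infty_ge.
apply: cvg_to1; near=> n.
have [cV dE p01] : [/\ #|V n| = n, average_degree R (G n) = d n &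
     0 <= p n <= 1] by near: n.
rewrite Pr_subgraph_le1 // andbT.
have g0 : good n 0%N by near: n; apply: goodE.
have [e1|[k /andP[gk gk'] ->]] := epsP n.
  have := eps_le n 0%N g0 (leq0n n); rewrite e1; lra.
(* The failure bound [2^-1 ^+ n] does not depend on [k], so [k] may vary with [n]. *)
have := KP k (V n) (G n) (p n) p01; rewrite dE cV; exact.
Unshelve. all: by end_near.
Qed.
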